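(* Let $X, X_1,X_2,\dots$ be i.i.d. nonnegative random variables with finite expectation and $\mathrm{P}(X=0)<1$, and let $\alpha_0\doteq 0.34149$ be the unique value of $\alpha$ such that $\int_0^1 (y-y\ln y+\alpha)^{-1}\,dy=1$. Then for all $t>0$, $$M(t)\le (1+\alpha_0)\,V(t).$$
   Context: Let $S_1<S_2<\cdots$ be the arrival times of a homogeneous Poisson process with rate $\lambda=1$ on $(0,\infty)$, independent of the sequence $X_1,X_2,\dots$; the value $X_k$ is observed at time $S_k$. Let $N(t)$ be the number of arrivals up to time $t$, i.e. $N(t)=\max\{k\ge 0: S_k\le t\}$ with $S_0=0$. Define $$M(t):=\mathrm{E}\big(\max\{X_1,\dots,X_{N(t)}\}\big),$$ where the maximum of an empty set is taken to be $0$, and $$V(t):=\sup_{\tau\in\mathcal{T}}\mathrm{E}\big[X_\tau\,\mathrm{I}(S_\tau\le t)\big],$$ where $\mathrm{I}$ denotes an indicator and $\mathcal{T}$ is the set of all $\mathbb{N}$-valued random variables (stopping rules) $\tau$ such that, for each $i$, the event $\{\tau=i\}$ is measurable with respect to the $\sigma$-algebra generated by $(X_1,S_1),\dots,(X_i,S_i)$. *)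

(* Defs.v *)
From HB Require Import structures.
From mathcomp Require Import all_boot all_order all_algebra finmap.
From mathcomp Require Import all_classical all_reals all_analysis.

Set Implicit Arguments.
Unset Strict Implicit.
Unset Printing Implicit Defensive.

Import Order.TTheory GRing.Theory Num.Theory.
Import numFieldNormedType.Exports.

Local Open Scope classical_set_scope.
Local Open Scope ring_scope.
Local Open Scope ereal_scope.

(* Sequences of random variables are indexed from 1, as in X_1, X_2, ...; the
   value at index 0 is unused, except that S 0 = 0 for arrival times. *)

(* The sets must be measurable: the value of a measure on a nonmeasurable set
   carries no information. *)
Definition has_law (d : measure_display) (T : measurableType d) (R : realType)
    (P : probability T R) (Y : T -> R) (nu : set R -> \bar R) : Prop :=
  forall A : set R, measurable A -> P (Y @^-1` A) = nu A.

Definition mutually_independent (d : measure_display) (T : measurableType d)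
    (R : realType) (P : probability T R) (Y : nat -> T -> R) : Prop :=
  forall (J : {fset nat}) (B : nat -> set R),
    (forall k, measurable (B k)) ->
    P (\bigcap_(k in [set` J]) Y k @^-1` B k) =
    \prod_(k <- J) P (Y k @^-1` B k).

Definition sigma_seq (d : measure_display) (T : measurableType d)
    (R : realType) (Y : nat -> T -> R) : set (set T) :=
  <<s \bigcup_(k in [set: nat]) preimage_set_system setT (Y k) measurable >>.

Definition independent_seqs (d : measure_display) (T : measurableType d)
    (R : realType) (P : probability T R) (Y Z : nat -> T -> R) : Prop :=
  forall A B : set T, sigma_seq Y A -> sigma_seq Z B ->
    P (A `&` B) = P A * P B.

Definition iid_as (d : measure_display) (T : measurableType d)
    (R : realType) (P : probability T R) (X0 : {RV P >-> R})
    (X : nat -> {RV P >-> R}) : Prop :=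
  mutually_independent P (fun k => X k.+1) /\
  (forall k, (1 <= k)%N -> has_law P (X k) (distribution P X0)).

Definition poisson_arrivals (d : measure_display) (T : measurableType d)
    (R : realType) (P : probability T R) (lambda : R)
    (S : nat -> {RV P >-> R}) : Prop :=
  [/\ forall w, S 0%N w = 0%R,
      mutually_independent P (fun k w => S k.+1 w - S k w)%R &
      forall k, has_law P (fun w => S k.+1 w - S k w)%R
                          (exponential_prob lambda)].

(* N(t) = max {k >= 0 : S_k <= t}; the value is 0 on the null event where this
   set has no maximum. *)
Definition arrivals_upto (T : Type) (R : realType) (S : nat -> T -> R)
    (t : R) (w : T) : nat :=
  xget 0%N [set k | (S k w <= t)%R /\ forall j, (S j w <= t)%R -> (j <= k)%N].

(* With X_i >= 0, starting the maximum from 0 only affects the empty one. *)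
Definition M_value (d : measure_display) (T : measurableType d)
    (R : realType) (P : probability T R) (X S : nat -> T -> R) (t : R) :
    \bar R :=
  'E_P[fun w => \big[Num.max/0%R]_(1 <= i < (arrivals_upto S t w).+1) X i w].

Definition stopping_rule (d : measure_display) (T : measurableType d)
    (R : realType) (X S : nat -> T -> R) (tau : T -> nat) : Prop :=
  (forall w, (1 <= tau w)%N) /\
  (forall i, (1 <= i)%N ->
    <<s \bigcup_(j in [set j | (1 <= j <= i)%N])
          g_sigma_preimageU (X j) (S j) >> (tau @^-1` [set i])).

Definition V_value (d : measure_display) (T : measurableType d)
    (R : realType) (P : probability T R) (X S : nat -> T -> R) (t : R) :
    \bar R :=
  ereal_sup [set 'E_P[fun w => (X (tau w) w *
                                \1_[set w' | (S (tau w') w' <= t)%R] w)%R]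
            | tau in stopping_rule X S].

Definition alpha_integral (R : realType) (alpha : R) : \bar R :=
  \int[lebesgue_measure]_(y in `[0%R, 1%R])
    ((y - y * ln y + alpha)^-1)%:E.

(* Main.v *)
From Stdlib Require Import ZArith.
Require Import Defs.
From HB Require Import structures.
From mathcomp Require Import all_boot all_order all_algebra finmap.
From mathcomp Require Import all_classical all_reals all_analysis.
From mathcomp Require Import measurable_realfun ring lra zify ssrZ.

(* Write p(x) = P(X > x), Psi(v) = E max(X, v) and g(y) = y - y ln y.  By
   independent thinning, M(t) is at most the integral of 1 - exp(-t p(x)) over
   x >= 0.  For V(t), accept with remaining time s any value above a threshold
   w(s); this earns at least w(t) as soon as w(s) is at most the reward of
   waiting, exp(-s) * int_0^s exp(x) Psi(w(x)) dx.  With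
     rho(z) = int_0^oo min(- ln z, t p(x)) dx,
     r(y) = t * int_0^y (g + a)^-1,   w(r(y)) = (int_0^y rho) / (g(y) + a),
   the bound min(c, t p(x)) <= (c if x < v, else t p(x)), integrated at
   c = - ln z, turns into the differential form w' <= Psi(w) - w of that
   condition.  Since r(1) = t exactly when alpha_integral a = 1, the value at
   y = 1 is (1 + a) w(t) = int_0^1 rho = int_0^oo (1 - exp(-t p(x))) dx. *)

Set Implicit Arguments.
Unset Strict Implicit.
Unset Printing Implicit Defensive.

Import Order.TTheory GRing.Theory Num.Theory.
Import numFieldNormedType.Exports.

Local Open Scope classical_set_scope.
Local Open Scope ring_scope.
Local Open Scope ereal_scope.

(** * The integral defining alpha0 *)

(** The optimal value solves [w' = Psi(w) - w] in the remaining time, which has no closed form for a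
    general law. An explicit subsolution is enough, and no optimal rule is ever constructed. Its
    shape comes from the bound on min(c, t p), which controls [Psi(v)] from below by a function
    linear in v with slope governed by c. Letting c = - ln y vary with the clock y leaves a linear
    equation for w, and since g' = - ln, division by g + a solves it.

    Both sides of the inequality rest on a single identity, [reward_step], for a rule that stops
    when the pair (value, remaining time) enters a given set. Iterated on a subsolution it bounds V
    from below, up to a survival probability that decays geometrically. Iterated on an exact
    solution it bounds the tail of the maximum from above, by summing over the index of the first
    exceedance; this is the form that thinning takes here.

    The number alpha0 brings two tasks of its own: uniqueness among all reals, where a negative
    alpha puts a pole inside the unit interval or makes the integrand nonpositive, and a certified
    numerical bracket. *)

Lemma measurable_invr (R : realType) : measurable_fun [set: R] (@GRing.inv R).
Proof.
have -> : [set: R] = [set~ 0%R] `|` [set 0%R] by rewrite setUC setUv.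
apply/measurable_funU => //; first exact: measurableC.
split; last exact: measurable_fun_set1.
apply: open_continuous_measurable_fun.
  by rewrite openC; exact: closed_eq.
by move=> x /[!inE] /eqP x0; exact: inv_continuous.
Qed.

Section entropy_integral.
Context {R : realType}.
Implicit Types (a b c x y z : R).
Notation mu := (@lebesgue_measure R).

(** The primitive of [- ln] vanishing at 0, concave and increasing from 0 to 1 on the unit interval.
    The identity [g_ent' = - ln] is what the threshold function exploits. *)
Definition g_ent (y : R) : R := (y - y * ln y)%R.

Lemma g_ent0 : g_ent 0 = 0%R.
Proof. by rewrite /g_ent mul0r subr0. Qed.

(* The tangent line of the concave function [g_ent] at [c]. *)
Lemma g_ent_le_tangent c z : (0 < c)%R -> (0 <= z)%R ->
  (g_ent z <= c - z * ln c)%R.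
Proof.
move=> c0; rewrite le_eqVlt => /predU1P[<-|z0].
  by rewrite g_ent0 mul0r subr0 ltW.
have : (ln (c / z) <= c / z - 1)%R.
  have := @le_ln1Dx R (c / z - 1); rewrite addrCA subrr addr0; apply.
  by rewrite -subr_gt0 opprK subrK divr_gt0.
rewrite ln_div ?posrE// -(ler_pM2l z0) !mulrBr mulr1 mulrCA divff ?gt_eqF// mulr1.
by rewrite /g_ent; lra.
Qed.

Lemma g_ent_ge y : (0 <= y <= 1)%R -> (y <= g_ent y)%R.
Proof. by move=> /andP[y0 y1]; have := ln_le0 y1; rewrite /g_ent; nra. Qed.

Lemma g_ent_ge0 y : (0 <= y <= 1)%R -> (0 <= g_ent y)%R.
Proof. by move=> y01; apply: le_trans (g_ent_ge y01); case/andP: y01. Qed.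

Lemma g_ent_le1 y : (0 <= y <= 1)%R -> (g_ent y <= 1)%R.
Proof.
move=> /andP[y0 _]; have := @g_ent_le_tangent 1 y ltr01 y0.
by rewrite ln1 mulr0 subr0.
Qed.

Lemma measurable_g_ent : measurable_fun [set: R] g_ent.
Proof. by apply: measurable_funB => //; exact: measurable_funM. Qed.

Lemma continuous_g_ent y : (0 < y)%R -> {for y, continuous g_ent}.
Proof.
move=> y0; apply: cvgB; first exact: cvg_id.
by apply: cvgM; [exact: cvg_id|exact: continuous_ln].
Qed.

Definition f_ent a y : R := (g_ent y + a)^-1%R.

Lemma measurable_f_ent a : measurable_fun [set: R] (f_ent a).
Proof.
apply: (measurableT_comp (@measurable_invr R)).
by apply: measurable_funD => //; exact: measurable_g_ent.
Qed.

Lemma f_ent_gt0 a y : (0 < a)%R -> (0 <= y <= 1)%R -> (0 < f_ent a y)%R.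
Proof. by move=> a0 /g_ent_ge0 y0; rewrite invr_gt0; lra. Qed.

Lemma f_ent_le a y : (0 < a)%R -> (0 <= y <= 1)%R -> (f_ent a y <= a^-1)%R.
Proof. by move=> a0 /g_ent_ge0 y0; rewrite lef_pV2 ?posrE//; lra. Qed.

Lemma continuous_f_ent a y : (0 < a)%R -> (0 < y <= 1)%R ->
  {for y, continuous (f_ent a)}.
Proof.
move=> a0 /andP[y0 y1]; apply: cvgV.
  by rewrite gt_eqF//; have := @g_ent_ge0 y; lra.
by apply: cvgD; [exact: continuous_g_ent|exact: cvg_cst].
Qed.

Lemma alpha_integralE a :
  alpha_integral a = \int[mu]_(y in `[0%R, 1%R]) (f_ent a y)%:E.
Proof. by []. Qed.

Lemma f_ent_dist a b y : (0 < g_ent y + a)%R -> (a <= b)%R ->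
  (f_ent a y - f_ent b y = (b - a) * f_ent a y * f_ent b y)%R.
Proof.
move=> ga ab; rewrite /f_ent; field.
by rewrite !gt_eqF//; lra.
Qed.

Lemma mEf_ent a (D : set R) : measurable_fun D (fun y => (f_ent a y)%:E).
Proof. apply/measurable_funTS/measurable_EFinP; exact: measurable_f_ent. Qed.

Lemma integral_const_itv (k p q : R) : (p <= q)%R ->
  \int[mu]_(y in `[p, q]) k%:E = (k * (q - p))%:E.
Proof.
rewrite (integral_cst mu)//= lebesgue_measure_itv/= lte_fin.
rewrite le_eqVlt => /predU1P[->|->]; first by rewrite ltxx subrr mule0 mulr0.
by rewrite -EFinD -EFinM.
Qed.

Lemma integral_const_unit (k : R) :
  \int[mu]_(y in `[0%R, 1%R]) k%:E = k%:E.
Proof. by rewrite integral_const_itv// subr0 mulr1. Qed.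

Lemma alpha_integral_ge0 a : (0 <= a)%R -> 0 <= alpha_integral a.
Proof.
move=> a0; rewrite alpha_integralE; apply: integral_ge0 => y /=.
rewrite in_itv/= => y01; rewrite lee_fin invr_ge0.
by have := g_ent_ge0 y01; lra.
Qed.

Lemma alpha_integral_fin_num a : (0 < a)%R -> alpha_integral a \is a fin_num.
Proof.
move=> a0; rewrite ge0_fin_numE ?alpha_integral_ge0 1?ltW// alpha_integralE.
apply: (@le_lt_trans _ _ (\int[mu]_(y in `[0%R, 1%R]) (a^-1)%:E)).
  apply: ge0_le_integral => //.
  - by move=> y /=; rewrite in_itv/= => y01; rewrite lee_fin ltW// f_ent_gt0.
  - exact: mEf_ent.
  - by move=> y /=; rewrite in_itv/= => y01; rewrite lee_fin f_ent_le.
by rewrite integral_const_unit ltry.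
Qed.

(** Strict monotonicity in quantitative form: the integrands differ by
    [(b - a) * f_ent a y * f_ent b y], and [g_ent <= 1] bounds both factors from below. *)
Lemma alpha_integral_gap a b : (0 <= a)%R -> (a <= b)%R ->
  alpha_integral b + ((b - a) / ((1 + a) * (1 + b)))%:E <= alpha_integral a.
Proof.
move=> a0 ab; rewrite !alpha_integralE.
set k := (_ / _)%R.
have k0 : (0 <= k)%R by rewrite divr_ge0//; nra.
rewrite -[X in _ + X](integral_const_unit k) -ge0_integralD//; last 2 first.
- move=> y /=; rewrite in_itv/= => y01; rewrite lee_fin invr_ge0.
  by have := g_ent_ge0 y01; lra.
- exact: mEf_ent.
(* For [a = 0] the denominator vanishes at 0, so that endpoint is removed before comparing
   pointwise. *)
rewrite -!(@integral_itv_obnd_cbnd R 0%R (BRight 1%R)); last 2 first.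
- exact: mEf_ent.
- apply: emeasurable_funD => //; exact: mEf_ent.
have pos x y : (0 <= x)%R -> y \in `]0%R, 1%R] -> (0 < g_ent y + x)%R.
  move=> x0; rewrite in_itv/= => /andP[y0 y1].
  by have := @g_ent_ge y; lra.
apply: ge0_le_integral => //.
- move=> y /= y01; rewrite -EFinD lee_fin addr_ge0// invr_ge0 ltW//.
  by apply: pos => //; lra.
- by apply: emeasurable_funD => //; exact: mEf_ent.
- exact: mEf_ent.
- move=> y /= y01; rewrite -EFinD lee_fin addrC -lerBrDr.
  rewrite f_ent_dist ?pos// -mulrA; apply: ler_wpM2l; first lra.
  move: (pos _ _ a0 y01) (pos b y ltac:(lra) y01); rewrite in_itv/= in y01.
  have := @g_ent_le1 y; rewrite /f_ent -invfM => y1 pa pb.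
  rewrite lef_pV2 ?posrE; [|nra..].
  by apply: ler_pM; lra.
Qed.

Lemma alpha_integral_lt a b : (0 <= a)%R -> (a < b)%R ->
  alpha_integral b < alpha_integral a.
Proof.
move=> a0 ab; apply: lt_le_trans (alpha_integral_gap a0 (ltW ab)).
rewrite lteDl ?alpha_integral_fin_num//; last lra.
by rewrite lte_fin divr_gt0//; nra.
Qed.

(** The same difference of integrands, now bounded above through [f_ent <= a^-1]. *)
Lemma alpha_integral_dist a b : (0 < a)%R -> (a <= b)%R ->
  alpha_integral a <= alpha_integral b + ((b - a) / a ^+ 2)%:E.
Proof.
move=> a0 ab; rewrite !alpha_integralE.
have k0 : (0 <= (b - a) / a ^+ 2)%R by rewrite divr_ge0//; nra.
rewrite -[X in _ + X](integral_const_unit _) -ge0_integralD//; last 2 first.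
- by move=> y /=; rewrite in_itv/= => y01; rewrite lee_fin ltW// f_ent_gt0//; lra.
- exact: mEf_ent.
apply: ge0_le_integral => //.
- by move=> y /=; rewrite in_itv/= => y01; rewrite lee_fin ltW// f_ent_gt0//; lra.
- exact: mEf_ent.
- by apply: emeasurable_funD => //; exact: mEf_ent.
- move=> y /=; rewrite in_itv/= => y01; rewrite -EFinD lee_fin addrC -lerBlDr.
  have y0 := g_ent_ge0 y01.
  rewrite f_ent_dist//; last lra.
  rewrite -mulrA; apply: ler_wpM2l; first lra.
  have b0 : (0 < b)%R by lra.
  rewrite -exprVn expr2; apply: ler_pM; try by apply: ltW; exact: f_ent_gt0.
  + exact: f_ent_le.
  + apply: (@le_trans _ _ b^-1%R); first exact: f_ent_le.
    by rewrite lef_pV2 ?posrE//; lra.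
Qed.

Lemma alpha_integral_fine_dist a b c : (0 < c)%R -> (c <= a)%R -> (c <= b)%R ->
  (`|fine (alpha_integral a) - fine (alpha_integral b)| <= `|a - b| / c ^+ 2)%R.
Proof.
move=> c0; wlog ab : a b / (a <= b)%R.
  move=> H ca cb; have [ab|/ltW ba] := leP a b; first exact: H.
  by rewrite distrC [in leRHS]distrC; exact: H.
move=> ca cb.
have a0 := lt_le_trans c0 ca; have b0 := lt_le_trans c0 cb.
have := alpha_integral_dist a0 ab.
have := alpha_integral_gap (ltW a0) ab.
rewrite -(fineK (alpha_integral_fin_num a0)) -(fineK (alpha_integral_fin_num b0)).
rewrite -!EFinD !lee_fin => h1 h2.
have k0 : (0 <= (b - a) / ((1 + a) * (1 + b)))%R by rewrite divr_ge0//; nra.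
have k1 : ((b - a) / a ^+ 2 <= (b - a) / c ^+ 2)%R.
  apply: ler_wpM2l; first lra.
  by rewrite lef_pV2 ?posrE ?exprn_gt0// lerXn2r// nnegrE ltW.
rewrite ger0_norm; last lra.
by rewrite distrC (@ger0_norm _ (b - a)); lra.
Qed.

Lemma alpha_integral_IVT a b : (0 < a)%R -> (a <= b)%R ->
  1 <= alpha_integral a -> alpha_integral b <= 1 ->
  exists2 c, (a <= c <= b)%R & alpha_integral c = 1.
Proof.
move=> a0 ab Ia Ib; pose J x := fine (alpha_integral x).
have JE x : (a <= x)%R -> alpha_integral x = (J x)%:E.
  by move=> ax; rewrite fineK// alpha_integral_fin_num//; lra.
have cJ : {within `[a, b], continuous J}.
  apply/continuous_in_subspaceT => /= x; rewrite inE/= in_itv/= => /andP[ax xb].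
  apply/cvgrPdist_le => e e0.
  have d0 : (0 < Num.min (a / 2) (e * (a / 2) ^+ 2))%R.
    by rewrite lt_min divr_gt0//= mulr_gt0// exprn_gt0// divr_gt0.
  (* The first bound keeps [y] above [a / 2], where the integral is Lipschitz with constant
     [(a / 2) ^- 2]; the second turns that constant into [e]. *)
  exists (Num.min (a / 2) (e * (a / 2) ^+ 2))%R => //= y.
  rewrite /ball_/= lt_min => /andP[xy1 xy2].
  have := @alpha_integral_fine_dist x y (a / 2); move/(_ _ _ _)/le_trans; apply.
  - lra.
  - lra.
  - by move: xy1; rewrite ltr_distlC; lra.
  - by rewrite ler_pdivrMr ?exprn_gt0//; lra.
have [|c] := @IVT R J a b 1 ab cJ.
  move: Ia Ib; rewrite !JE// !lee_fin => Ja Jb.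
  by rewrite ge_min le_max Ja Jb orbT.
by rewrite in_itv/= => acb Jc; exists c => //; rewrite JE ?Jc//; case/andP: acb.
Qed.

Lemma ge0_integral_itv_split (f : R -> \bar R) (o p q : R) :
  (o <= p)%R -> (p <= q)%R -> measurable_fun [set: R] f ->
  (forall x, x \in `[o, q] -> 0 <= f x) ->
  \int[mu]_(x in `[o, q]) f x =
  \int[mu]_(x in `[o, p]) f x + \int[mu]_(x in `[p, q]) f x.
Proof.
move=> op pq mf f0.
have -> : `[o, q]%classic = `[o, p]%classic `|` `]p, q]%classic :> set R.
  by apply: itv_bndbnd_setU; rewrite bnd_simp.
rewrite ge0_integral_setU//=.
- by congr (_ + _); rewrite integral_itv_obnd_cbnd//; exact: measurable_funTS.
- exact: measurable_funTS.
- move=> x [] /=; rewrite !in_itv/= => x01; apply: f0; rewrite in_itv/=; lra.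
- apply/disj_setPS => x [] /=; rewrite !in_itv/=; lra.
Qed.

(** A simple pole is not integrable: each dyadic shell from [q - r n] to [q - r n / 2] contributes
    at least [1 / (2 * K)], independently of [n]. *)
Lemma integral_reciprocal_pinfty (f : R -> \bar R) (K q h : R) :
  (0 < K)%R -> (0 < h)%R -> measurable_fun [set: R] f ->
  (forall z, (q - h <= z <= q)%R -> 0 <= f z) ->
  (forall z, (q - h <= z < q)%R -> ((K * (q - z))^-1)%:E <= f z) ->
  \int[mu]_(z in `[(q - h)%R, q]) f z = +oo.
Proof.
move=> K0 h0 mf f0 fge.
pose r n := (h / 2 ^+ n)%R.
have r0 n : (0 < r n)%R by rewrite divr_gt0// exprn_gt0.
have rS n : (r n.+1 = r n / 2)%R.
  by rewrite /r exprSr invfM mulrA.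
have rh n : (r n <= h)%R.
  by elim: n => [|n IH]; [rewrite /r expr0 divr1|rewrite rS; have := r0 n; lra].
have A n : (n%:R / (2 * K))%:E <= \int[mu]_(z in `[(q - h)%R, (q - r n)%R]) f z.
  elim: n => [|n IH].
    rewrite mul0r; apply: integral_ge0 => z /=; rewrite in_itv/= => zq.
    by apply: f0; have := r0 0%N; lra.
  have := r0 n; have := rh n => h1 h2.
  rewrite (@ge0_integral_itv_split _ _ (q - r n)%R)//; last 3 first.
  - by lra.
  - by rewrite rS; lra.
  - by move=> z; rewrite in_itv/= rS => zq; apply: f0; lra.
  rewrite rS.
  rewrite -natr1 mulrDl EFinD; apply: leeD => //.
  apply: (@le_trans _ _
    (\int[mu]_(z in `[(q - r n)%R, (q - r n / 2)%R]) ((K * r n)^-1)%:E)).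
    rewrite integral_const_itv ?lee_fin; last lra.
    rewrite le_eqVlt; apply/orP; left; apply/eqP; field.
    by rewrite !gt_eqF.
  apply: ge0_le_integral => //.
  - by move=> z _; rewrite lee_fin invr_ge0 mulr_ge0// ltW.
  - exact: measurable_funTS.
  - move=> z /=; rewrite in_itv/= => zq; apply: le_trans (fge _ _); last lra.
    rewrite lee_fin lef_pV2 ?posrE ?mulr_gt0//; try lra.
    by apply: ler_wpM2l; lra.
apply/eqyP => M M0.
have [n Mn] : exists n : nat, (M <= n%:R / (2 * K))%R.
  exists (Num.bound (M * (2 * K)))%R.
  rewrite ler_pdivlMr; last lra.
  by apply: ltW; apply: le_lt_trans (archi_boundP _); rewrite ?mulr_ge0//; lra.
apply: (@le_trans _ _ (n%:R / (2 * K))%:E); first by rewrite lee_fin.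
apply: (le_trans (A n)).
have := r0 n; have := rh n => h1 h2.
apply: ge0_subset_integral => //.
- exact: measurable_funTS.
- by move=> z /=; rewrite !in_itv/=; lra.
Qed.

Lemma g_ent_root b : (0 < b < 1)%R -> exists2 y, (0 < y < 1)%R & g_ent y = b.
Proof.
(* A point where [g_ent] is below [b]: the tangent at [c = b / 2] gives [g_ent z <= c - z * ln c],
   and this [z] makes the last term smaller than [c]. *)
move=> /andP[b0 b1]; pose c := (b / 2)%R; pose z := (c / (1 - ln c))%R.
have lc : (ln c < 0)%R by apply: ln_lt0; rewrite /c; lra.
have c0 : (0 < c)%R by rewrite /c; lra.
have z0 : (0 < z)%R by rewrite divr_gt0//; lra.
have zc : (z <= c)%R by rewrite ler_pdivrMr; nra.
have gz : (g_ent z < b)%R.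
  have := g_ent_le_tangent c0 (ltW z0).
  suff : (- (z * ln c) < c)%R by rewrite /c; lra.
  by rewrite /z mulrAC -mulNr ltr_pdivrMr; nra.
have z1 : (z <= 1)%R by rewrite /c in zc; lra.
have [||y] := @IVT R g_ent z 1 b z1.
- apply/continuous_in_subspaceT => /= x; rewrite inE/= in_itv/= => /andP[zx _].
  by apply: continuous_g_ent; lra.
- have -> : g_ent 1 = 1%R by rewrite /g_ent ln1 mulr0 subr0.
  by rewrite ge_min le_max (ltW gz)/= (ltW b1) orbT.
rewrite in_itv/= => zy1 gy; exists y => //.
rewrite (lt_le_trans z0) ?(andP zy1).1//= lt_neqAle (andP zy1).2 andbT.
by apply/eqP => y1; move: gy; rewrite y1 /g_ent ln1 mulr0 subr0; lra.
Qed.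

(** For [a <= -1] the integrand is nonpositive. For [a] between -1 and 0 the denominator has a zero
    [q] inside the unit interval, and just to the left of [q] the negative part has a pole of
    infinite mass. *)
Lemma alpha_integral_neg a : (a < 0)%R -> alpha_integral a <> 1.
Proof.
move=> a0; rewrite alpha_integralE; have [a1|a1] := leP a (-1)%R.
  have -> : \int[mu]_(y in `[0%R, 1%R]) (f_ent a y)%:E =
           - \int[mu]_(y in `[0%R, 1%R]) (- f_ent a y)%:E.
    rewrite -integral_ge0N; first by apply: eq_integral => y _; rewrite EFinN oppeK.
    move=> y /=; rewrite in_itv/= => y01; rewrite lee_fin oppr_ge0 invr_le0.
    by have := g_ent_le1 y01; lra.
  have : 0 <= \int[mu]_(y in `[0%R, 1%R]) (- f_ent a y)%:E.
    apply: integral_ge0 => y /=; rewrite in_itv/= => y01.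
    by rewrite lee_fin oppr_ge0 invr_le0; have := g_ent_le1 y01; lra.
  move=> I0 I1; have : 1 <= (0 : \bar R) by rewrite -I1 oppe_le0.
  by rewrite lee_fin ler10.
have [|q q01 gq] := @g_ent_root (- a)%R; first lra.
pose fm := (fun y => (f_ent a y)%:E)^\-.
have fmE y : fm y = (Num.max (- f_ent a y) 0)%:E by rewrite /fm funenegE -EFinN -EFin_max.
have mfm : measurable_fun [set: R] fm by apply: measurable_funeneg; exact: mEf_ent.
(* Exceeds the slope [- ln z] of [g_ent] between [q / 2] and [q]. *)
pose K := (1 - ln (q / 2))%R.
have K0 : (0 < K)%R by rewrite subr_gt0; apply: lt_trans (@ltr01 R); apply: ln_lt0; lra.
have I : \int[mu]_(y in `[0%R, 1%R]) fm y = +oo.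
  apply/eqP; rewrite -leye_eq.
  rewrite -(@integral_reciprocal_pinfty fm K q (q / 2)%R)//; last 3 first.
  - lra.
  - by move=> z _; rewrite fmE lee_fin le_max lexx orbT.
  - move=> z zq; rewrite fmE lee_fin le_max; apply/orP; left.
    have z0 : (0 < z)%R by lra.
    have q0 : (0 <= q)%R by lra.
    have := g_ent_le_tangent z0 q0; rewrite gq => aq.
    have lz : (ln (q / 2) <= ln z)%R by rewrite ler_ln ?posrE; lra.
    have gza : (- (g_ent z + a) <= K * (q - z))%R.
      by rewrite /K; rewrite /g_ent; nra.
    rewrite /f_ent -invrN lef_pV2 ?posrE//; first by rewrite mulr_gt0//; lra.
    rewrite oppr_gt0.
    have lq : (ln q < 0)%R by apply: ln_lt0; lra.
    have q0' : (0 < q)%R by lra.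
    have := g_ent_le_tangent q0' (ltW z0); move: gq; rewrite /g_ent; nra.
  apply: ge0_subset_integral => //.
  - exact: measurable_funTS.
  - by move=> z _; rewrite fmE lee_fin le_max lexx orbT.
  - by move=> z /=; rewrite !in_itv/=; lra.
(* The positive part minus [+oo] is [-oo], even if the positive part is infinite, by the convention
   for extended reals. *)
by rewrite integralE -/fm I; case: (\int[mu]_(x in _) _).
Qed.

Lemma alpha_integral_unique a : (0 < a)%R -> alpha_integral a = 1 ->
  unique (fun b : R => alpha_integral b = 1) a.
Proof.
move=> a0 Ia; split=> // b Ib.
have [b0|b0] := leP 0%R b; last by have := alpha_integral_neg b0.
apply/eqP; rewrite eq_le !leNgt; apply/andP; split; apply/negP => ab.
- by have := alpha_integral_lt b0 ab; rewrite Ia Ib ltxx.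
- by have := alpha_integral_lt (ltW a0) ab; rewrite Ia Ib ltxx.
Qed.

End entropy_integral.

(** * Quadrature bounds for the entropy integral *)

Section entropy_quadrature.
Context {R : realType}.
Implicit Types (a p q s z A B C u v : R).
Notation mu := (@lebesgue_measure R).

(** Centred at the midpoint, so that the slope integrates to 0; both quadrature rules below compare
    [f_ent] with such an affine function. *)
Lemma integral_affine p q A B : (p <= q)%R ->
  \int[mu]_(z in `[p, q]) (A + B * (z - (p + q) / 2))%:E = (A * (q - p))%:E.
Proof.
rewrite le_eqVlt => /predU1P[<-|pq].
  by rewrite set_itv1 integral_set1 subrr mulr0.
pose F (z : R) := (A * z + B / 2 * (z - (p + q) / 2) ^+ 2)%R.
have dF (z : R) : is_derive z 1%R F (A + B * (z - (p + q) / 2))%R.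
  rewrite /F; apply: is_derive_eq; rewrite /GRing.scale/=.
  by field.
have cf : continuous (fun z : R => A + B * (z - (p + q) / 2))%R.
  move=> x; apply: cvgD; first exact: cvg_cst.
  by apply: cvgM; [exact: cvg_cst|apply: cvgB; [exact: cvg_id|exact: cvg_cst]].
have cF (y : R) : {for y, continuous F}.
  by apply: differentiable_continuous; apply/derivable1_diffP.
transitivity ((F q)%:E - (F p)%:E).
  apply: (@continuous_FTC2 _ (fun z => A + B * (z - (p + q) / 2))%R F) => //.
  - exact: continuous_subspaceT.
  - split.
    + by move=> x _.
    + exact: cvg_at_right_filter (cF p).
    + exact: cvg_at_left_filter (cF q).
  - by move=> x _; rewrite derive1E derive_val.
by rewrite -EFinB; congr EFin; rewrite /F; field.
Qed.

(** Convexity: [f_ent a] is the reciprocal of a positive concave function. *)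
Lemma f_ent_chord a p q z : (0 < a)%R -> (0 < p)%R -> (p < q)%R -> (q <= 1)%R ->
  (p <= z <= q)%R ->
  ((q - p) * f_ent a z <= (q - z) * f_ent a p + (z - p) * f_ent a q)%R.
Proof.
move=> a0 p0 pq q1 /andP[pz zq].
have gp : (0 < g_ent p + a)%R by have := @g_ent_ge0 R p; lra.
have gq : (0 < g_ent q + a)%R by have := @g_ent_ge0 R q; lra.
have gz : (0 < g_ent z + a)%R by have := @g_ent_ge0 R z; lra.
have z0 : (0 < z)%R by lra.
(* Concavity of [g_ent], from its tangent line at [z] evaluated at [p] and at [q]. *)
have conc : ((q - z) * (g_ent p + a) + (z - p) * (g_ent q + a) <=
             (q - p) * (g_ent z + a))%R.
  have hp : (0 <= p)%R by lra.
  have hq : (0 <= q)%R by lra.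
  have qz : (0 <= q - z)%R by lra.
  have zp : (0 <= z - p)%R by lra.
  have := ler_wpM2l qz (g_ent_le_tangent z0 hp).
  have := ler_wpM2l zp (g_ent_le_tangent z0 hq).
  by rewrite [g_ent z]/g_ent; lra.
(* the tangent of [1/x] at [g_ent z + a] *)
have tang x : (0 < x)%R ->
    (2 * f_ent a z - x * f_ent a z ^+ 2 <= x^-1)%R.
  move=> x0; rewrite -subr_ge0 (_ : _ - _ = x^-1 * (1 - x * f_ent a z) ^+ 2)%R.
    by rewrite mulr_ge0 ?sqr_ge0// invr_ge0 ltW.
  by field; rewrite gt_eqF.
have fz0 : (0 < f_ent a z)%R by rewrite invr_gt0.
have : ((q - z) * (2 * f_ent a z - (g_ent p + a) * f_ent a z ^+ 2) +
        (z - p) * (2 * f_ent a z - (g_ent q + a) * f_ent a z ^+ 2) <=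
        (q - z) * f_ent a p + (z - p) * f_ent a q)%R.
  by apply: lerD; apply: ler_wpM2l; try lra; exact: tang.
apply: le_trans.
have : ((q - p) * (g_ent z + a) * f_ent a z ^+ 2 = (q - p) * f_ent a z)%R.
  by rewrite /f_ent; field; rewrite gt_eqF.
have := ler_wpM2r (sqr_ge0 (f_ent a z)) conc.
by lra.
Qed.

Lemma integral_f_ent_trapezoid a p q u v : (0 < a)%R -> (0 < p)%R -> (p <= q)%R ->
  (q <= 1)%R -> (f_ent a p <= u)%R -> (f_ent a q <= v)%R ->
  \int[mu]_(z in `[p, q]) (f_ent a z)%:E <= ((q - p) * (v + u) / 2)%:E.
Proof.
move=> a0 p0 + q1 pu qv; rewrite le_eqVlt => /predU1P[<-|pq].
  by rewrite set_itv1 integral_set1 subrr !mul0r.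
have -> : ((q - p) * (v + u) / 2)%:E = \int[mu]_(z in `[p, q])
    ((v + u) / 2 + (v - u) / (q - p) * (z - (p + q) / 2))%:E.
  rewrite integral_affine ?ltW//.
  by have -> : ((q - p) * (v + u) / 2 = (v + u) / 2 * (q - p))%R by lra.
apply: ge0_le_integral => //.
- by move=> z /=; rewrite in_itv/= => zpq; rewrite lee_fin ltW// f_ent_gt0//; lra.
- exact: mEf_ent.
- apply/measurable_EFinP; apply: measurable_funD => //.
  by apply: measurable_funM => //; exact: measurable_funB.
- move=> z /=; rewrite in_itv/= => zpq; rewrite lee_fin.
  rewrite -(ler_pM2l (_ : 0 < q - p)%R); last lra.
  apply: le_trans (f_ent_chord _ _ _ _ zpq) _ => //.
  have -> : ((q - p) * ((v + u) / 2 + (v - u) / (q - p) * (z - (p + q) / 2)) =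
             (q - z) * u + (z - p) * v)%R.
    by field; rewrite gt_eqF// subr_gt0.
  by apply: lerD; apply: ler_wpM2l => //; lra.
Qed.

(** Two tangents: [g_ent z + a] lies below its tangent at [exp (- s)], hence below
    [A + s * (z - m)], and the reciprocal of the latter lies above its own tangent at the midpoint
    [m], whose integral is exactly [(q - p) / A]. *)
Lemma integral_f_ent_midpoint a p q s C : (0 < a)%R -> (0 <= p)%R -> (p <= q)%R ->
  (q <= 1)%R -> (0 <= s)%R -> (expR (- s) <= C)%R ->
  ((q - p) / (C + s * ((p + q) / 2) + a))%:E <=
  \int[mu]_(z in `[p, q]) (f_ent a z)%:E.
Proof.
move=> a0 p0 pq q1 s0 sC; set m := ((p + q) / 2)%R.
have C0 := lt_le_trans (expR_gt0 (- s)) sC.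
set A := (C + s * m + a)%R.
have A0 : (0 < A)%R by rewrite /A /m; nra.
rewrite mulrC -(@integral_affine p q A^-1 (- (s * A^-1 ^+ 2)))//.
have V0 : (0 < A^-1)%R by rewrite invr_gt0.
have key z : (p <= z <= q)%R ->
    (0 <= A^-1 - s * A^-1 ^+ 2 * (z - m))%R /\
    (A^-1 - s * A^-1 ^+ 2 * (z - m) <= f_ent a z)%R.
  move=> zpq; set d := (s * (z - m))%R.
  have -> : (A^-1 - s * A^-1 ^+ 2 * (z - m) = A^-1 ^+ 2 * (A - d))%R.
    by rewrite /d; field; rewrite gt_eqF.
  have dA : (d < A)%R by rewrite /d /A /m; nra.
  have Ad : (0 < A + d)%R by rewrite /d /A /m; nra.
  split; first by rewrite mulr_ge0 ?sqr_ge0//; lra.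
  apply: (@le_trans _ _ (A + d)^-1%R).
    rewrite -subr_ge0 (_ : _ - _ = (A + d)^-1 * (d * A^-1) ^+ 2)%R.
      by rewrite mulr_ge0 ?sqr_ge0// invr_ge0 ltW.
    by field; rewrite !gt_eqF.
  have gz : (0 < g_ent z + a)%R by have := @g_ent_ge0 R z; lra.
  rewrite lef_pV2 ?posrE//.
  have z0 : (0 <= z)%R by lra.
  have := g_ent_le_tangent (expR_gt0 (- s)) z0; rewrite expRK.
  by rewrite /A /d; lra.
apply: ge0_le_integral => //.
- by move=> z /=; rewrite in_itv/= => zpq; rewrite lee_fin mulNr (key z zpq).1.
- apply/measurable_EFinP; apply: measurable_funD => //.
  by apply: measurable_funM => //; exact: measurable_funB.
- exact: mEf_ent.
- by move=> z /=; rewrite in_itv/= => zpq; rewrite lee_fin mulNr (key z zpq).2.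
Qed.

End entropy_quadrature.

(** * Numerical enclosure of alpha0 *)

Section fixed_point_checks.
Local Open Scope Z_scope.

(* A fixed-point integer [x] stands for [x / 2 ^ 32] (in the computation of
   exponentials, [x / 2 ^ 80]), and [a] for [a / 10 ^ 6]. *)
Definition fp_scale : Z := 2 ^ 32.
Definition fp_fine : Z := 2 ^ 80.

Definition mul_down (d x y : Z) : Z := x * y / d.
Definition mul_up (d x y : Z) : Z := x * y / d + 1.

(* Bounds [f_ent a y] for [y <= exp (- i / 128)], where [- ln y >= i / 128]. *)
Definition f_up (a i Y : Z) : Z :=
  128 * 1000000 * fp_scale * fp_scale /
   (Y * (128 + i) * 1000000 + 128 * a * fp_scale) + 1.

(* Trapezoidal sums, valid by convexity of [f_ent], on the mesh
   [exp (- i / 128)]; below the last node, [f_ent a <= 1 / a]. *)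
Fixpoint upper_check (a rho : Z) (n : nat) (i Y F S : Z) : bool :=
  if n is n'.+1 then
    let Y' := mul_down fp_scale Y rho in
    let F' := f_up a (i + 1) Y' in
    [&& 0 <? Y', Y' <=? Y &
      upper_check a rho n' (i + 1) Y' F' (S + (Y - Y') * (F + F'))]
  else S * a + 2 * fp_scale * Y * 1000000 <=? 2 * fp_scale * fp_scale * a.

(* Midpoint rule for the reciprocal of the tangent [C + i / 256 * y + a] of
   [g_ent + a] at [C ~ exp (- i / 256)]. *)
Definition cell_down (a i C Y Y' : Z) : Z :=
  (Y - Y') * fp_scale * 512 * 1000000 /
   (C * 512 * 1000000 + i * (Y + Y') * 1000000 + a * 512 * fp_scale).

Fixpoint lower_check (a rho : Z) (n : nat) (i Y S : Z) : bool :=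
  if n is n'.+1 then
    let C := mul_up fp_scale Y rho in
    let Y' := mul_up fp_scale C rho in
    [&& 0 <? Y', Y' <=? Y &
      lower_check a rho n' (i + 2) Y' (S + cell_down a (i + 1) C Y Y')]
  else fp_scale <=? S + cell_down a i Y Y 0.

(** Repeated squaring: 30 squarings of [1 - x], with [x = 2 ^ -37], approach [exp (- 1 / 128)] from
    below. For the upper bound 29 squarings start from [1 - x + x ^ 2], which dominates [exp (- x)];
    here [x ^ 2] is the integer [2 ^ 6]. The 48 guard bits absorb the accumulated rounding. *)
Definition exp_down128 : Z :=
  ssrnat.iter 30 (fun x => mul_down fp_fine x x) (fp_fine - 2 ^ 43) / 2 ^ 48.
Definition exp_up256 : Z :=
  ssrnat.iter 29 (fun x => mul_up fp_fine x x) (fp_fine - 2 ^ 43 + 2 ^ 6) / 2 ^ 48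
  + 1.

(** Certifies that the integral is at most 1 at 0.341495, with 1088 cells going down to about
    [exp (- 8.5)]. The companion check at 0.341485 has 896 cells, down to about [exp (- 7)]. *)
Lemma upper_check_vm :
  upper_check 341495 exp_down128 1088 0 fp_scale (f_up 341495 0 fp_scale) 0.
Proof. vm_cast_no_check (erefl true). Qed.

Lemma lower_check_vm :
  lower_check 341485 exp_up256 896 0 fp_scale 0.
Proof. vm_cast_no_check (erefl true). Qed.

End fixed_point_checks.

Delimit Scope Z_scope with ZZ.

(* Locked, lest conversion expand large integers in unary. *)
HB.lock Definition zr (R : realType) (x : Z) : R := (int_of_Z x)%:~R.

(** * Fixed-point integers as real numbers *)

Section integer_embedding.
Context {R : realType}.
Implicit Types x y : Z.
Notation zr := (@zr R).

Lemma zrD x y : zr (x + y)%ZZ = (zr x + zr y)%R.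
Proof. by rewrite !zr.unlock -intrD -rmorphD. Qed.

Lemma zrM x y : zr (x * y)%ZZ = (zr x * zr y)%R.
Proof. by rewrite !zr.unlock -intrM -rmorphM. Qed.

Lemma zrB x y : zr (x - y)%ZZ = (zr x - zr y)%R.
Proof. by rewrite !zr.unlock -intrB -rmorphB. Qed.

Lemma zr1 : zr 1%ZZ = 1%R. Proof. by rewrite zr.unlock. Qed.

Lemma zr0 : zr 0%ZZ = 0%R. Proof. by rewrite zr.unlock. Qed.

Lemma zr_le x y : (x <= y)%ZZ -> (zr x <= zr y)%R.
Proof. by move=> xy; rewrite !zr.unlock ler_int; lia. Qed.

Lemma zr_lt x y : (x < y)%ZZ -> (zr x < zr y)%R.
Proof. by move=> xy; rewrite !zr.unlock ltr_int; lia. Qed.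

Lemma zr_nat (n : nat) : zr (Z.of_nat n) = n%:R.
Proof.
have e : int_of_Z (Z.of_nat n) = n :> int by lia.
by rewrite zr.unlock e -pmulrn.
Qed.

Lemma zr_pow2 (n : nat) : zr (2 ^ Z.of_nat n)%ZZ = (2 ^+ n)%R.
Proof.
elim: n => [|n IH]; first by rewrite zr1 expr0.
rewrite Nat2Z.inj_succ Z.pow_succ_r; last by lia.
by rewrite zrM IH exprS (zr_nat 2).
Qed.

Lemma zr_div_le x y : (0 < y)%ZZ -> (zr (x / y)%ZZ * zr y <= zr x)%R.
Proof.
by move=> y0; rewrite -zrM; apply: zr_le; rewrite Z.mul_comm; exact: Z.mul_div_le.
Qed.

Lemma zr_div_up x y : (0 < y)%ZZ -> (zr x <= zr (x / y + 1)%ZZ * zr y)%R.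
Proof.
move=> y0; rewrite -zrM; apply: zr_le.
by have := Z.mul_succ_div_gt x y y0; rewrite -Z.add_1_r Z.mul_comm; lia.
Qed.

Definition fpr (d x : Z) : R := (zr x / zr d)%R.

Lemma fpr_ge0 d x : (0 < d)%ZZ -> (0 <= x)%ZZ -> (0 <= fpr d x)%R.
Proof.
move=> /zr_lt; rewrite zr0 => d0 /zr_le; rewrite zr0 => x0.
by rewrite divr_ge0// ltW.
Qed.

Lemma fpr_mul_down d x y : (0 < d)%ZZ ->
  (fpr d (mul_down d x y) <= fpr d x * fpr d y)%R.
Proof.
move=> /[dup] d0 /zr_lt; rewrite zr0 => zd0.
have := zr_div_le (x * y) d0; rewrite zrM => h.
rewrite /fpr (_ : zr x / zr d * (zr y / zr d) = zr x * zr y / zr d / zr d)%R.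
  by rewrite ler_pM2r ?invr_gt0// ler_pdivlMr.
by field; rewrite gt_eqF.
Qed.

Lemma fpr_mul_up d x y : (0 < d)%ZZ ->
  (fpr d x * fpr d y <= fpr d (mul_up d x y))%R.
Proof.
move=> /[dup] d0 /zr_lt; rewrite zr0 => zd0.
have := zr_div_up (x * y) d0; rewrite zrM => h.
rewrite /fpr (_ : zr x / zr d * (zr y / zr d) = zr x * zr y / zr d / zr d)%R.
  by rewrite ler_pM2r ?invr_gt0// ler_pdivrMr.
by field; rewrite gt_eqF.
Qed.

Lemma mul_down_expR d x y (r s : R) : (0 < d)%ZZ -> (0 <= x)%ZZ -> (0 <= y)%ZZ ->
  (fpr d x <= expR (- r))%R -> (fpr d y <= expR (- s))%R ->
  (fpr d (mul_down d x y) <= expR (- (r + s)))%R.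
Proof.
move=> d0 x0 y0 hx hy; apply: le_trans (fpr_mul_down _ _ d0) _.
by rewrite opprD expRD; apply: ler_pM => //; exact: fpr_ge0.
Qed.

Lemma mul_up_expR d x y (r s : R) : (0 < d)%ZZ ->
  (expR (- r) <= fpr d x)%R -> (expR (- s) <= fpr d y)%R ->
  (expR (- (r + s)) <= fpr d (mul_up d x y))%R.
Proof.
move=> d0 hx hy; apply: le_trans (fpr_mul_up _ _ d0).
by rewrite opprD expRD; apply: ler_pM => //; exact: expR_ge0.
Qed.

Lemma mul_down_ge0 d x y : (0 < d)%ZZ -> (0 <= x)%ZZ -> (0 <= y)%ZZ ->
  (0 <= mul_down d x y)%ZZ.
Proof. by move=> d0 x0 y0; apply: Z.div_pos => //; lia. Qed.

Lemma iter_mul_down_expR d x (r : R) n : (0 < d)%ZZ -> (0 <= x)%ZZ ->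
  (fpr d x <= expR (- r))%R ->
  (fpr d (ssrnat.iter n (fun z => mul_down d z z) x) <= expR (- (r * 2 ^+ n)))%R.
Proof.
move=> d0 x0 hx; set u := ssrnat.iter _ _ _.
suff : (0 <= u)%ZZ /\ (fpr d u <= expR (- (r * 2 ^+ n)))%R by case.
rewrite {}/u; elim: n => [|n [u0 IH]]; first by rewrite /= expr0 mulr1.
split; first exact: mul_down_ge0.
rewrite /= exprS mulrCA mulr_natl mulr2n.
exact: mul_down_expR.
Qed.

Lemma iter_mul_up_expR d x (r : R) n : (0 < d)%ZZ ->
  (expR (- r) <= fpr d x)%R ->
  (expR (- (r * 2 ^+ n)) <= fpr d (ssrnat.iter n (fun z => mul_up d z z) x))%R.
Proof.
move=> d0 hx; elim: n => [|n IH]; first by rewrite /= expr0 mulr1.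
rewrite /= exprS mulrCA mulr_natl mulr2n.
exact: mul_up_expR.
Qed.

Lemma fpr_rescale (c d x : Z) : (0 < c)%ZZ -> (0 < d)%ZZ ->
  (fpr d (x / c) <= fpr (d * c) x)%R /\ (fpr (d * c) x <= fpr d (x / c + 1))%R.
Proof.
move=> /[dup] c0 /zr_lt; rewrite zr0 => zc0 /[dup] d0 /zr_lt; rewrite zr0 => zd0.
have h1 := zr_div_le x c0; have h2 := zr_div_up x c0.
have -> : fpr (d * c) x = (zr x / zr c / zr d)%R.
  by rewrite /fpr zrM invfM mulrA mulrAC.
by split; rewrite /fpr ler_pM2r ?invr_gt0// ?ler_pdivrMr ?ler_pdivlMr.
Qed.

Lemma zr_gt0 x : (0 < x)%ZZ -> (0 < zr x)%R.
Proof. by move=> /zr_lt; rewrite zr0. Qed.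

Lemma fprB d x y : fpr d (x - y)%ZZ = (fpr d x - fpr d y)%R.
Proof. by rewrite /fpr zrB mulrBl. Qed.

Lemma fprD d x y : fpr d (x + y)%ZZ = (fpr d x + fpr d y)%R.
Proof. by rewrite /fpr zrD mulrDl. Qed.

Lemma fprr d : (0 < d)%ZZ -> fpr d d = 1%R.
Proof. by move=> d0; rewrite /fpr divff// gt_eqF// zr_gt0. Qed.

Lemma fp_scale_gt0 : (0 < fp_scale)%ZZ. Proof. by []. Qed.

Lemma fp_fine_gt0 : (0 < fp_fine)%ZZ. Proof. by []. Qed.

Lemma fpr_base : (fpr fp_fine (2 ^ 43) = (2 ^+ 37)^-1 :> R)%R.
Proof.
rewrite /fpr /fp_fine (zr_pow2 43) (zr_pow2 80).
by rewrite (exprD _ 43 37) invfM mulrA divff ?mul1r// expf_neq0.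
Qed.

Lemma exp_down128P : (fpr fp_scale exp_down128 <= expR (- (128%:R^-1)) :> R)%R.
Proof.
rewrite /exp_down128; set u := ssrnat.iter _ _ _.
have [+ _] := @fpr_rescale (2 ^ 48) fp_scale u erefl fp_scale_gt0.
move=> /le_trans; apply.
rewrite (_ : (fp_scale * 2 ^ 48)%ZZ = fp_fine); last by [].
rewrite (_ : 128%:R^-1 = (2 ^+ 37)^-1 * 2 ^+ 30 :> R)%R; last by rewrite -exprVn; field.
apply: iter_mul_down_expR => //.
have := expR_ge1Dx (- ((2 ^+ 37)^-1) : R)%R.
by rewrite fprB (fprr fp_fine_gt0) fpr_base.
Qed.

Lemma expRN_le (x : R) : (0 <= x)%R -> (expR (- x) <= 1 - x + x ^+ 2)%R.
Proof.
move=> x0; rewrite expRN; apply: (@le_trans _ _ (1 + x)^-1%R).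
  by rewrite lef_pV2 ?posrE ?expR_gt0 ?expR_ge1Dx//; lra.
by rewrite -[leLHS]mul1r ler_pdivrMr; nra.
Qed.

Lemma exp_up256P : (expR (- (256%:R^-1)) <= fpr fp_scale exp_up256 :> R)%R.
Proof.
rewrite /exp_up256; set u := ssrnat.iter _ _ _.
have [_] := @fpr_rescale (2 ^ 48) fp_scale u erefl fp_scale_gt0.
apply: le_trans.
rewrite (_ : (fp_scale * 2 ^ 48)%ZZ = fp_fine); last by [].
rewrite (_ : 256%:R^-1 = (2 ^+ 37)^-1 * 2 ^+ 29 :> R)%R; last by rewrite -exprVn; field.
apply: iter_mul_up_expR => //.
have x0 : (0 <= (2 ^+ 37)^-1 :> R)%R by rewrite invr_ge0 exprn_ge0.
apply: le_trans (expRN_le x0) _.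
rewrite fprD fprB (fprr fp_fine_gt0) fpr_base lerD2l.
rewrite /fpr /fp_fine (zr_pow2 6) (zr_pow2 80).
have -> : (2 ^+ 80 = 2 ^+ 6 * (2 ^+ 37 * 2 ^+ 37) :> R)%R by rewrite -!exprD.
rewrite le_eqVlt; apply/orP; left; apply/eqP.
by field.
Qed.

End integer_embedding.

(** * Soundness of the fixed-point checks *)

Section fixed_point_soundness.
Local Opaque fp_scale.
Context {R : realType}.
Variable a : Z.
Hypothesis a_gt0 : (0 < a)%ZZ.
Notation mu := (@lebesgue_measure R).
Notation zr := (@zr R).
Notation fp := (@fpr R fp_scale).

Variable al : R.
Hypothesis alE : al = (zr a / zr 1000000)%R.

Let D0 : (0 < zr fp_scale)%R. Proof. exact: zr_gt0. Qed.
Let M0 : (0 < zr 1000000)%R. Proof. exact: zr_gt0. Qed.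
Let a0 : (0 < zr a)%R. Proof. exact: zr_gt0. Qed.
Let al0 : (0 < al)%R. Proof. by rewrite alE divr_gt0. Qed.

Let zr128 : zr 128 = 128%:R. Proof. exact: (zr_nat 128). Qed.
Let zr512 : zr 512 = 512%:R. Proof. exact: (zr_nat 512). Qed.
Let zr2 : zr 2 = 2%:R. Proof. exact: (zr_nat 2). Qed.

Let fp_itv Y : (0 < Y)%ZZ -> (Y <= fp_scale)%ZZ -> (0 < fp Y <= 1)%R.
Proof.
move=> /(@zr_gt0 R) Y0 /(@zr_le R) YD.
by rewrite /fpr divr_gt0//= ler_pdivrMr// mul1r.
Qed.

Lemma f_up_ge i Y : (0 <= i)%ZZ -> (0 < Y)%ZZ -> (Y <= fp_scale)%ZZ ->
  (fp Y <= expR (- (zr i / 128%:R)))%R ->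
  (f_ent al (fp Y) <= fp (f_up a i Y))%R.
Proof.
move=> i0 Y0 YD Yi; have /andP[y0 y1] := fp_itv Y0 YD.
have y01 : (0 <= fp Y <= 1)%R by rewrite (ltW y0).
have zi : (0 <= zr i)%R by rewrite -(@zr0 R); exact: zr_le.
have zY : (0 < zr Y)%R by exact: zr_gt0.
have lny : (ln (fp Y) <= - (zr i / 128%:R))%R.
  by rewrite -(expRK (- _)%R) ler_ln ?posrE ?expR_gt0.
set den := (Y * (128 + i) * 1000000 + 128 * a * fp_scale)%ZZ.
have denE : zr den = (zr Y * (128 + zr i) * zr 1000000 + 128 * zr a * zr fp_scale)%R.
  by rewrite /den zrD (zrM (Y * _)) (zrM Y) zrD (zrM (128 * a)) (zrM 128) zr128.
have zd : (0 < zr den)%R.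
  have h128 : (0 < 128 + zr i)%R by lra.
  by rewrite denE; apply: addr_gt0; do 2?apply: mulr_gt0.
have den0 : (0 < den)%ZZ by apply/Z.nle_gt => /(@zr_le R); rewrite zr0 leNgt zd.
have := @zr_div_up R (128 * 1000000 * fp_scale * fp_scale) den den0.
rewrite -ler_pdivrMr// => h.
rewrite [leRHS]/fpr ler_pdivlMr//; apply: le_trans h.
rewrite (zrM (128 * _ * _)) (zrM (128 * _)) (zrM 128) zr128.
have gG : (fp Y * (1 + zr i / 128) + al <= g_ent (fp Y) + al)%R.
  by have := ler_wpM2l (ltW y0) lny; rewrite lerD2r /g_ent; lra.
have G0 : (0 < fp Y * (1 + zr i / 128) + al)%R.
  have := divr_ge0 zi (ler0n R 128) => zi0.
  by apply: addr_gt0 al0; apply: mulr_gt0 y0 _; lra.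
apply: (@le_trans _ _ ((fp Y * (1 + zr i / 128) + al)^-1 * zr fp_scale)%R).
  by rewrite ler_pM2r// lef_pV2 ?posrE// (lt_le_trans G0).
rewrite le_eqVlt; apply/orP; left; apply/eqP.
rewrite denE /fpr alE; field.
by rewrite -denE !gt_eqF.
Qed.

(** The hypotheses are the loop invariant: [Y] stays below the exact node, [F] bounds [f_ent] there,
    and [S], in units of [1 / (2 * fp_scale ^ 2)], bounds the integral from the node up to 1. *)
Lemma upper_checkP rho n i Y F S : (0 <= rho)%ZZ ->
  (fp rho <= expR (- (128%:R^-1)))%R ->
  (0 <= i)%ZZ -> (0 < Y)%ZZ -> (Y <= fp_scale)%ZZ ->
  (fp Y <= expR (- (zr i / 128%:R)))%R -> (f_ent al (fp Y) <= fp F)%R ->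
  \int[mu]_(z in `[fp Y, 1%R]) (f_ent al z)%:E <=
    (zr S / (2 * zr fp_scale ^+ 2))%:E ->
  upper_check a rho n i Y F S -> alpha_integral al <= 1.
Proof.
move=> rho0 hrho; elim: n i Y F S => [|n IH] i Y F S i0 Y0 YD Yi YF YS /=.
  move=> /Z.leb_le /(@zr_le R).
  rewrite zrD (zrM S a) (zrM (2 * fp_scale * Y) 1000000) (zrM (2 * fp_scale) Y).
  rewrite (zrM (2 * fp_scale * fp_scale) a) (zrM (2 * fp_scale) fp_scale).
  rewrite (zrM 2 fp_scale) zr2 => h.
  have /andP[y0 y1] := fp_itv Y0 YD.
  rewrite alpha_integralE (@ge0_integral_itv_split _ _ _ (fp Y))//; last 3 first.
  - by rewrite ltW.
  - exact: mEf_ent.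
  - by move=> z; rewrite in_itv/= => z01; rewrite lee_fin ltW// f_ent_gt0.
  apply: (@le_trans _ _ ((al^-1 * (fp Y - 0))%:E + (zr S / (2 * zr fp_scale ^+ 2))%:E)).
    apply: leeD YS; rewrite -integral_const_itv; last exact: ltW.
    apply: ge0_le_integral => //.
    - move=> z /=; rewrite in_itv/= => z01; rewrite lee_fin ltW// f_ent_gt0//.
      by lra.
    - exact: mEf_ent.
    - by move=> z /=; rewrite in_itv/= => z01; rewrite lee_fin f_ent_le//; lra.
  rewrite -EFinD lee_fin subr0 -(@ler_pM2r _ (2 * zr fp_scale ^+ 2 * zr a)%R); last first.
    by rewrite !mulr_gt0// exprn_gt0.
  rewrite mul1r; apply: le_trans (le_trans h _); last by rewrite expr2; lra.
  rewrite le_eqVlt; apply/orP; left; apply/eqP; rewrite alE /fpr; field.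
  by rewrite !gt_eqF.
move=> /and3P[/Z.ltb_lt Y'0 /Z.leb_le Y'Y].
have i1 : (0 <= i + 1)%ZZ by apply: Z.le_trans i0 _; exact: Z.le_succ_diag_r.
have Y'D : (mul_down fp_scale Y rho <= fp_scale)%ZZ by exact: Z.le_trans Y'Y YD.
have Y'i : (fp (mul_down fp_scale Y rho) <= expR (- (zr (i + 1) / 128%:R)))%R.
  rewrite zrD zr1 mulrDl mul1r.
  by apply: mul_down_expR => //; exact: Z.lt_le_incl.
have f' := f_up_ge i1 Y'0 Y'D Y'i.
apply: IH => //.
have /andP[y0 y1] := fp_itv Y0 YD.
have /andP[y'0 y'1] := fp_itv Y'0 Y'D.
have yy' : (fp (mul_down fp_scale Y rho) <= fp Y)%R.
  by rewrite /fpr ler_pM2r ?invr_gt0//; exact: zr_le.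
rewrite (@ge0_integral_itv_split _ _ _ (fp Y))//; last 2 first.
- exact: mEf_ent.
- by move=> z; rewrite in_itv/= => z01; rewrite lee_fin ltW// f_ent_gt0//; lra.
rewrite zrD zrM (zrB Y) (zrD F) mulrDl EFinD addeC.
apply: leeD YS _.
apply: le_trans (integral_f_ent_trapezoid al0 y'0 yy' y1 f' YF) _.
rewrite lee_fin le_eqVlt; apply/orP; left; apply/eqP; rewrite /fpr; field.
by rewrite !gt_eqF.
Qed.

Lemma cell_downP i C Y Y' : (0 <= i)%ZZ -> (0 <= Y')%ZZ -> (Y' <= Y)%ZZ ->
  (Y <= fp_scale)%ZZ -> (expR (- (zr i / 256%:R)) <= fp C)%R ->
  (fp (cell_down a i C Y Y'))%:E <=
  \int[mu]_(z in `[fp Y', fp Y]) (f_ent al z)%:E.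
Proof.
move=> i0 Y'0 Y'Y YD iC.
have s0 : (0 <= zr i / 256%:R)%R.
  by apply: divr_ge0; [rewrite -(@zr0 R); exact: zr_le|exact: ler0n].
have y'0 : (0 <= fp Y')%R by apply: fpr_ge0; rewrite ?fp_scale_gt0.
have y'y : (fp Y' <= fp Y)%R by rewrite /fpr ler_pM2r ?invr_gt0//; exact: zr_le.
have y1 : (fp Y <= 1)%R by rewrite /fpr ler_pdivrMr// mul1r; exact: zr_le.
apply: le_trans (integral_f_ent_midpoint al0 y'0 y'y y1 s0 iC).
have C0 : (0 < fp C)%R by apply: lt_le_trans iC; exact: expR_gt0.
have zC : (0 < zr C)%R by move: C0; rewrite /fpr pmulr_lgt0 ?invr_gt0.
set den := (C * 512 * 1000000 + i * (Y + Y') * 1000000 + a * 512 * fp_scale)%ZZ.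
have denE : zr den = (zr C * 512 * zr 1000000 + zr i * (zr Y + zr Y') * zr 1000000 +
                      zr a * 512 * zr fp_scale)%R.
  by rewrite /den 2!zrD (zrM (C * _)) (zrM C) (zrM (i * _)) (zrM i) (zrD Y)
    (zrM (a * _)) (zrM a) zr512.
have zi : (0 <= zr i)%R by rewrite -(@zr0 R); exact: zr_le.
have zY' : (0 <= zr Y')%R by rewrite -(@zr0 R); exact: zr_le.
have zY : (0 <= zr Y)%R by rewrite -(@zr0 R); apply: zr_le; exact: Z.le_trans Y'Y.
have zd : (0 < zr den)%R.
  rewrite denE; apply: ltr_wpDr.
    exact: mulr_ge0 (mulr_ge0 (ltW a0) (ler0n R 512)) (ltW D0).
  apply: ltr_wpDr.
    exact: mulr_ge0 (mulr_ge0 zi (addr_ge0 zY zY')) (ltW M0).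
  by apply: mulr_gt0 M0; apply: mulr_gt0 zC _; rewrite ltr0n.
have den0 : (0 < den)%ZZ by apply/Z.nle_gt => /(@zr_le R); rewrite zr0 leNgt zd.
have := @zr_div_le R ((Y - Y') * fp_scale * 512 * 1000000) den den0.
rewrite -ler_pdivlMr// => h.
rewrite lee_fin {1}/fpr ler_pdivrMr//; apply: le_trans h _.
rewrite (zrM (_ * _ * 512)) (zrM (_ * _)) (zrM (Y - Y')) zrB zr512.
rewrite le_eqVlt; apply/orP; left; apply/eqP.
have denr0 : zr den != 0%R by rewrite gt_eqF.
rewrite /fpr (_ : _ + _ + al = zr den / (512 * zr fp_scale * zr 1000000))%R.
  by field; rewrite denr0 !gt_eqF.
by rewrite denE alE; field; rewrite !gt_eqF.
Qed.

(** Loop invariant as for [upper_checkP], with nodes rounded up: a value above [exp (- i / 256)] is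
    an admissible constant [C] in the tangent to [g_ent]. *)
Lemma lower_checkP rho n i Y S : (expR (- (256%:R^-1)) <= fp rho)%R ->
  (0 <= i)%ZZ -> (0 < Y)%ZZ -> (Y <= fp_scale)%ZZ ->
  (expR (- (zr i / 256%:R)) <= fp Y)%R ->
  (fp S)%:E <= \int[mu]_(z in `[fp Y, 1%R]) (f_ent al z)%:E ->
  lower_check a rho n i Y S -> 1 <= alpha_integral al.
Proof.
move=> hrho; elim: n i Y S => [|n IH] i Y S i0 Y0 YD Yi YS /=.
  move=> /Z.leb_le /(@zr_le R); rewrite zrD => h.
  have /andP[y0 y1] := fp_itv Y0 YD.
  rewrite alpha_integralE (@ge0_integral_itv_split _ _ _ (fp Y))//; last 3 first.
  - by rewrite ltW.
  - exact: mEf_ent.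
  - by move=> z; rewrite in_itv/= => z01; rewrite lee_fin ltW// f_ent_gt0.
  (* The last cell reaches down to 0 and uses the tangent at its own right end. *)
  have c := @cell_downP i Y Y 0 i0 (Z.le_refl _) (Z.lt_le_incl _ _ Y0) YD Yi.
  have fp0 : fp 0 = 0%R by rewrite /fpr zr0 mul0r.
  rewrite fp0 in c; rewrite addeC; apply: le_trans (leeD YS c).
  rewrite -EFinD lee_fin -fprD -(@fprr R _ fp_scale_gt0) /fpr ler_pM2r ?invr_gt0//.
  by rewrite zrD.
move=> /and3P[/Z.ltb_lt Y'0 /Z.leb_le Y'Y].
have i1 : (0 <= i + 1)%ZZ by apply: Z.le_trans i0 _; exact: Z.le_succ_diag_r.
have i2E : (i + 2 = i + 1 + 1)%ZZ by rewrite -Z.add_assoc.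
have i2 : (0 <= i + 2)%ZZ by rewrite i2E; apply: Z.le_trans i1 _; exact: Z.le_succ_diag_r.
have Y'D := Z.le_trans _ _ _ Y'Y YD.
have Ci : (expR (- (zr (i + 1) / 256%:R)) <= fp (mul_up fp_scale Y rho))%R.
  by rewrite zrD zr1 mulrDl mul1r; apply: mul_up_expR.
have Y'i : (expR (- (zr (i + 2) / 256%:R)) <=
    fp (mul_up fp_scale (mul_up fp_scale Y rho) rho))%R.
  by rewrite i2E zrD zr1 mulrDl mul1r; apply: mul_up_expR.
apply: IH => //.
have /andP[y0 y1] := fp_itv Y0 YD.
have /andP[y'0 y'1] := fp_itv Y'0 Y'D.
rewrite (@ge0_integral_itv_split _ _ _ (fp Y))//; last 3 first.
- by rewrite /fpr ler_pM2r ?invr_gt0//; exact: zr_le.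
- exact: mEf_ent.
- by move=> z; rewrite in_itv/= => z01; rewrite lee_fin ltW// f_ent_gt0//; lra.
rewrite fprD EFinD addeC; apply: leeD YS.
by apply: cell_downP => //; exact: Z.lt_le_incl.
Qed.

End fixed_point_soundness.

Lemma alpha0_exists (R : realType) : exists2 alpha0 : R,
  (`|alpha0 - 34149%:R / 10 ^+ 5| <= 5%:R / 10 ^+ 6)%R & alpha_integral alpha0 = 1.
Proof.
have num (n : nat) : zr R (Z.of_nat n) = n%:R by exact: zr_nat.
pose lo : R := (zr R 341485 / zr R 1000000)%R.
pose hi : R := (zr R 341495 / zr R 1000000)%R.
have M : zr R 1000000 = (10 ^+ 6)%R.
  have -> : 1000000%ZZ = (10 * 10 * 10 * 10 * 10 * 10)%ZZ by [].
  by rewrite !zrM (num 10%N) !exprS expr0 mulr1 !mulrA.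
have E : zr R 341490 = (34149%:R * 10)%R.
  by rewrite -(num 34149%N) -(num 10%N) -zrM; congr (zr R _); vm_compute.
have lo_hi : (lo = 34149%:R / 10 ^+ 5 - 5%:R / 10 ^+ 6 /\
             hi = 34149%:R / 10 ^+ 5 + 5%:R / 10 ^+ 6)%R.
  have -> : lo = ((zr R 341490 - 5%:R) / 10 ^+ 6)%R by rewrite -(num 5%N) -zrB -M.
  have -> : hi = ((zr R 341490 + 5%:R) / 10 ^+ 6)%R by rewrite -(num 5%N) -zrD -M.
  by rewrite E; split; field.
have fp1 : fpr fp_scale fp_scale = 1%R :> R by exact: fprr.
have e0 k : (expR (- (zr R 0 / k%:R)) = 1 :> R)%R by rewrite zr0 mul0r oppr0 expR0.
have hi1 : alpha_integral hi <= 1.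
  have i0 : (0 <= 0)%ZZ by exact: Z.le_refl.
  have rho0 : (0 <= exp_down128)%ZZ by vm_compute.
  have Y1 : (fpr fp_scale fp_scale <= expR (- (zr R 0 / 128%:R)))%R by rewrite fp1 e0.
  have F1 : (f_ent hi (fpr fp_scale fp_scale) <=
             fpr fp_scale (f_up 341495 0 fp_scale))%R.
    exact: (f_up_ge (a := 341495) erefl erefl i0 fp_scale_gt0 (Z.le_refl _) Y1).
  apply: (upper_checkP (a := 341495) erefl erefl rho0 exp_down128P i0
    fp_scale_gt0 (Z.le_refl _) Y1 F1 _ upper_check_vm).
  by rewrite fp1 set_itv1 integral_set1 zr0 mul0r.
have lo1 : 1 <= alpha_integral lo.
  have Y1 : (expR (- (zr R 0 / 256%:R)) <= fpr fp_scale fp_scale)%R by rewrite fp1 e0.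
  apply: (lower_checkP (a := 341485) erefl erefl exp_up256P (Z.le_refl _)
    fp_scale_gt0 (Z.le_refl _) Y1 _ lower_check_vm).
  by rewrite fp1 set_itv1 integral_set1 /fpr zr0 mul0r.
case: lo_hi => loE hiE.
have lo0 : (0 < lo)%R by rewrite divr_gt0//; exact: zr_gt0.
have lohi : (lo <= hi)%R by rewrite loE hiE; lra.
have [c lch Ic] := alpha_integral_IVT lo0 lohi lo1 hi1.
exists c => //; rewrite ler_norml; move: lch; rewrite loE hiE.
by move: (_ / 10 ^+ 5)%R (_ / 10 ^+ 6)%R => u v; lra.
Qed.

(** * The threshold function *)

Section primitive0.
Context {R : realType}.
Notation mu := (@lebesgue_measure R).
Variables (b : R) (f : R -> R).
Hypothesis intf : mu.-integrable `[0%R, b] (EFin \o f).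

Definition primitive0 (y : R) : R := parameterized_integral mu 0%R y f.

Lemma primitive0_continuous : (0 <= b)%R -> {within `[0%R, b], continuous primitive0}.
Proof. by move=> b0; exact: parameterized_integral_continuous. Qed.

Lemma primitive0_is_derive y : y \in `]0%R, b[ -> {for y, continuous f} ->
  is_derive y 1%R primitive0 (f y).
Proof.
rewrite in_itv/= => /andP[y0 yb] cf.
have [d e] := continuous_FTC1_closed yb intf y0 cf.
by apply: (DeriveDef d); rewrite -derive1E; exact: e.
Qed.

Lemma primitive0E y : (y <= b)%R ->
  (primitive0 y)%:E = \int[mu]_(x in `[0%R, y]) (f x)%:E.
Proof.
move=> yb; rewrite /primitive0 /parameterized_integral /Rintegral fineK//.
apply: integrable_fin_num => //.
by apply: integrableS intf => //; apply: subset_itvl; rewrite bnd_simp.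
Qed.

Lemma primitive0_0 : primitive0 0 = 0%R.
Proof. by rewrite /primitive0 /parameterized_integral set_itv1 Rintegral_set1. Qed.

End primitive0.

Section cap_integral.
Context {R : realType}.
Notation mu := (@lebesgue_measure R).

(** Under Lebesgue measure on the unit interval [- ln z] is a standard exponential variable, and
    this is the mean of its minimum with [theta]. The integral splits at [c = exp (- theta)], where
    the two arguments of the minimum cross. *)
Lemma integral_min_ln (theta : R) : (0 <= theta)%R ->
  \int[mu]_(z in `[0%R, 1%R]) (Num.min (- ln z) theta)%:E = (1 - expR (- theta))%:E.
Proof.
move=> th0; pose c : R := expR (- theta); rewrite -/c.
have c0 : (0 < c)%R by exact: expR_gt0.
have c1 : (c <= 1)%R by rewrite expR_le1; lra.
have mm : measurable_fun [set: R] (fun z : R => (Num.min (- ln z) theta)%:E).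
  apply/measurable_EFinP; apply: measurable_minr => //.
  by apply: measurableT_comp => //; exact: measurable_ln.
rewrite (@ge0_integral_itv_split _ _ _ c)//; last 2 first.
- exact: ltW.
- move=> z; rewrite in_itv/= => /andP[z0 z1]; rewrite lee_fin le_min th0 andbT.
  by have := ln_le0 z1; lra.
have -> : \int[mu]_(z in `[0%R, c]) (Num.min (- ln z) theta)%:E = (theta * c)%:E.
  transitivity (\int[mu]_(z in `[0%R, c]) theta%:E); last first.
    by rewrite integral_const_itv ?subr0// ltW.
  (* The endpoint 0, where [ln] has a default value, is removed. *)
  rewrite -!(@integral_itv_obnd_cbnd R 0%R (BRight c)); last 2 first.
  - exact: measurable_cst.
  - exact: measurable_funTS.
  apply: eq_integral => z; rewrite inE/= in_itv/= => /andP[z0 zc]; congr EFin.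
  apply/min_idPr; rewrite -lerNr -(expRK (- theta)%R) ler_ln ?posrE//.
have -> : \int[mu]_(z in `[c, 1%R]) (Num.min (- ln z) theta)%:E =
          \int[mu]_(z in `[c, 1%R]) (- ln z)%:E.
  apply: eq_integral => z; rewrite inE/= in_itv/= => /andP[cz z1]; congr EFin.
  apply/min_idPl; rewrite -lerNl -(expRK (- theta)%R) ler_ln ?posrE//.
  exact: lt_le_trans cz.
have -> : \int[mu]_(z in `[c, 1%R]) (- ln z)%:E = (g_ent 1)%:E - (g_ent c)%:E.
  have [->|/eqP c1'] := eqVneq c 1%R; first by rewrite set_itv1 integral_set1 subee.
  have cl (z : R) : (c <= z)%R -> {for z, continuous (fun z : R => - ln z)%R}.
    by move=> cz; apply: cvgN; apply: continuous_ln; lra.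
  have dg (z : R) : (c < z)%R -> is_derive z 1%R (@g_ent R) (- ln z)%R.
    move=> cz; have z0 : (0 < z)%R by lra.
    have := is_derive1_ln z0 => dl.
    rewrite /g_ent; apply: is_derive_eq; rewrite /GRing.scale/=.
    by field; rewrite gt_eqF.
  apply: (@continuous_FTC2 _ (fun z => - ln z)%R (@g_ent R)).
  - by rewrite lt_neqAle c1 andbT; apply/eqP.
  - apply: continuous_in_subspaceT => z; rewrite inE/= in_itv/= => /andP[cz _].
    exact: cl.
  - split.
    + by move=> z; rewrite in_itv/= => /andP[cz _]; apply: ex_derive; exact: dg.
    + by apply: cvg_at_right_filter; exact: continuous_g_ent.
    + by apply: cvg_at_left_filter; exact: continuous_g_ent.
  - move=> z; rewrite in_itv/= => /andP[cz _]; have := dg z cz => ?.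
    by rewrite derive1E derive_val.
rewrite -EFinB -EFinD; congr EFin; rewrite /g_ent ln1 expRK; ring.
Qed.

End cap_integral.

Lemma fubini_tonelli_setX d1 d2 (T1 : measurableType d1) (T2 : measurableType d2)
    (R : realType) (m1 : {sigma_finite_measure set T1 -> \bar R})
    (m2 : {sigma_finite_measure set T2 -> \bar R}) (A : set T1) (B : set T2)
    (f : T1 * T2 -> \bar R) :
  measurable A -> measurable B -> measurable_fun (A `*` B) f ->
  (forall x y, A x -> B y -> 0 <= f (x, y)) ->
  \int[m1]_(x in A) \int[m2]_(y in B) f (x, y) =
  \int[m2]_(y in B) \int[m1]_(x in A) f (x, y).
Proof.
move=> mA mB mf f0; pose F := f \_ (A `*` B).
have mF : measurable_fun [set: T1 * T2] F.
  by apply/(measurable_restrictT _ _).1 => //; exact: measurableX.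
have F0 xy : 0 <= F xy.
  by rewrite /F patchE; case: ifPn => //; rewrite inE; case: xy => x y [/=]; exact: f0.
have FE x y : F (x, y) = if (x \in A) && (y \in B) then f (x, y) else 0.
  by rewrite /F patchE in_setX.
transitivity (\int[m1]_x \int[m2]_y F (x, y)).
  rewrite [LHS]integral_mkcond; apply: eq_integral => x _; rewrite patchE.
  case: ifPn => xA; last first.
    by rewrite integral0_eq// => y _; rewrite FE (negbTE xA).
  by rewrite integral_mkcond; apply: eq_integral => y _; rewrite patchE FE xA.
transitivity (\int[m2]_y \int[m1]_x F (x, y)); first exact: (fubini_tonelli F mF F0).
rewrite [RHS]integral_mkcond; apply: eq_integral => y _; rewrite patchE.
case: ifPn => yB; last first.
  by rewrite integral0_eq// => x _; rewrite FE (negbTE yB) andbF.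
by rewrite [RHS]integral_mkcond; apply: eq_integral => x _; rewrite patchE FE yB andbT.
Qed.

(** * An explicit subsolution by a change of clock *)

Section subsolution.
Context {R : realType}.
Notation mu := (@lebesgue_measure R).
Implicit Types (s x y z u v : R).
Variables (a t m : R) (p Psi : R -> R).
Hypothesis a0 : (0 < a)%R.
Hypothesis Ia : alpha_integral a = 1.
Hypothesis t0 : (0 < t)%R.
Hypothesis mp : measurable_fun [set: R] p.
Hypothesis p0 : forall x, (0 <= p x)%R.
Hypothesis Im : \int[mu]_(x in `[0%R, +oo[) (p x)%:E = m%:E.
Hypothesis PsiL : forall u v, (`|Psi u - Psi v| <= `|u - v|)%R.
Hypothesis PsiE : forall v, (0 <= v)%R ->
  (Psi v)%:E = \int[mu]_(x in `[0%R, +oo[) (if (x < v)%R then 1 else p x)%:E.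

Let D : set R := `[0%R, +oo[%classic.
Let mD : measurable D. Proof. exact: measurable_itv. Qed.

Let kap (z x : R) : R := Num.min (- ln z)%R (t * p x)%R.

Let tp0 x : (0 <= t * p x)%R. Proof. by apply: mulr_ge0 => //; exact: ltW. Qed.

Let kap0 z x : (z <= 1)%R -> (0 <= kap z x)%R.
Proof. by move=> z1; rewrite /kap le_min tp0 andbT oppr_ge0 ln_le0. Qed.

Let kap_le z x : (kap z x <= t * p x)%R. Proof. by rewrite /kap ge_min lexx orbT. Qed.

Let mtp : measurable_fun [set: R] (fun x => t * p x)%R.
Proof. by apply: measurable_funM. Qed.

Let mkap z : measurable_fun [set: R] (kap z).
Proof. by apply: measurable_minr. Qed.

Let Itp : \int[mu]_(x in D) (t * p x)%:E = (t * m)%:E.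
Proof.
under eq_integral do rewrite EFinM.
rewrite ge0_integralZl//=.
- by rewrite Im.
- exact/measurable_funTS/measurable_EFinP.
- by move=> x _; rewrite lee_fin.
- by rewrite lee_fin ltW.
Qed.

Let tm0 : (0 <= t * m)%R.
Proof. by rewrite -lee_fin -Itp; apply: integral_ge0 => x _; rewrite lee_fin. Qed.

Let int_tp : mu.-integrable D (EFin \o (fun x => t * p x)%R).
Proof.
apply/integrableP; split; first exact/measurable_funTS/measurable_EFinP.
under eq_integral do rewrite /= ger0_norm//.
by rewrite Itp ltry.
Qed.

Let int_kap z : (z <= 1)%R -> mu.-integrable D (EFin \o kap z).
Proof.
move=> z1; apply: le_integrable int_tp => //.
- by apply/measurable_funTS/measurable_EFinP; exact: mkap.
- by move=> x _ /=; rewrite lee_fin (ger0_norm (kap0 _ z1)) (ger0_norm (tp0 _)).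
Qed.

Definition rho z : R := (\int[mu]_(x in D) kap z x)%R.

Let rhoE z : (z <= 1)%R -> (rho z)%:E = \int[mu]_(x in D) (kap z x)%:E.
Proof.
move=> z1; rewrite /rho /Rintegral fineK//.
by apply: integrable_fin_num => //; exact: int_kap.
Qed.

Let rho_bounds z : (z <= 1)%R -> (0 <= rho z <= t * m)%R.
Proof.
move=> z1; rewrite -!lee_fin rhoE// -Itp; apply/andP; split.
  by apply: integral_ge0 => x _; rewrite lee_fin kap0.
apply: ge0_le_integral => //.
- by move=> x _; rewrite lee_fin kap0.
- by apply/measurable_funTS/measurable_EFinP; exact: mkap.
- exact/measurable_funTS/measurable_EFinP.
- by move=> x _; rewrite lee_fin kap_le.
Qed.

Let rho_continuous z : z \in `]0%R, 1%R[ -> {for z, continuous rho}.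
Proof.
move=> z01.
apply: (@continuity_under_integral R _ _ mu kap D mD 0%R 1%R _ _ (fun x => t * p x)%R
  int_tp); last by rewrite inE.
- by move=> x /=; rewrite in_itv/= => /andP[_ x1]; apply: int_kap; exact: ltW.
- apply: aeW => x _ y; rewrite inE/= in_itv/= => /andP[y0 y1].
  apply: (@continuous_min R R (fun z => - ln z)%R (cst (t * p x)%R) y).
    by apply: continuousN; exact: continuous_ln.
  exact: cst_continuous.
- move=> x /=; rewrite in_itv/= => /andP[_ x1]; apply: aeW => y _.
  by rewrite ger0_norm ?kap0 ?kap_le// ltW.
Qed.

Let measurable_rho : measurable_fun (`[0%R, 1%R]%classic : set R) rho.
Proof.
have mo : measurable_fun (`]0%R, 1%R[%classic : set R) rho.
  apply: open_continuous_measurable_fun; first exact: interval_open.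
  by move=> z /set_mem; exact: rho_continuous.
exact: measurable_fun_itv_cc mo.
Qed.

Let int_rho : mu.-integrable `[0%R, 1%R] (EFin \o rho).
Proof.
apply: measurable_bounded_integrable => //.
  by rewrite /= lebesgue_measure_itv/= lte_fin ltr01 -EFinD ltry.
exists (t * m)%R; split; first by rewrite num_real.
move=> M tmM z /=; rewrite in_itv/= => /andP[_ z1].
have /andP[h1 h2] := rho_bounds z1.
by rewrite ger0_norm// (le_trans h2)// ltW.
Qed.

Let L := primitive0 rho.

Let L_bounds y : (0 <= y <= 1)%R -> (0 <= L y <= t * m * y)%R.
Proof.
move=> y01; have /andP[y0 y1] := y01.
have my : measurable_fun (`[0%R, y]%classic : set R) rho.
  by apply: measurable_funS measurable_rho => //; apply: subset_itvl; rewrite bnd_simp.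
rewrite -!lee_fin (primitive0E int_rho y1); apply/andP; split.
  apply: integral_ge0 => z /=; rewrite in_itv/= => /andP[_ zy].
  by rewrite lee_fin; case/andP: (rho_bounds (le_trans zy y1)).
rewrite -[y in leRHS]subr0 -integral_const_itv//; apply: ge0_le_integral => //.
- move=> z /=; rewrite in_itv/= => /andP[_ zy].
  by rewrite lee_fin; case/andP: (rho_bounds (le_trans zy y1)).
- exact/measurable_EFinP.
- move=> z /=; rewrite in_itv/= => /andP[_ zy].
  by rewrite lee_fin; case/andP: (rho_bounds (le_trans zy y1)).
Qed.

(** After exchanging the integrals, each [x] contributes [integral_min_ln] at [theta = t * p x]. *)
Let L1 : (L 1)%:E = \int[mu]_(x in D) (1 - expR (- (t * p x)))%:E.
Proof.
rewrite (primitive0E int_rho)//.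
transitivity (\int[mu]_(z in `[0%R, 1%R]) \int[mu]_(x in D) (kap z x)%:E).
  by apply: eq_integral => z; rewrite inE/= in_itv/= => /andP[_ z1]; rewrite rhoE.
rewrite (@fubini_tonelli_setX _ _ _ _ R mu mu _ _ (fun zx => (kap zx.1 zx.2)%:E))//=.
- by apply: eq_integral => x _; exact: integral_min_ln.
- apply/measurable_funTS/measurable_EFinP; apply: measurable_minr.
    by do 2 apply: measurableT_comp => //.
  by apply: measurable_funM => //; exact: measurableT_comp.
- by move=> z x; rewrite in_itv/= lee_fin => /andP[_ z1] _; exact: kap0.
Qed.

Let r y : R := (t * primitive0 (f_ent a) y)%R.

Let int_f : mu.-integrable `[0%R, 1%R] (EFin \o f_ent a).
Proof.
apply/integrableP; split; first exact: mEf_ent.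
have <- : alpha_integral a = \int[mu]_(x in `[0%R, 1%R]) `|(EFin \o f_ent a) x|.
  rewrite alpha_integralE; apply: eq_integral => z; rewrite inE/= in_itv/= => z01.
  by rewrite gtr0_norm ?f_ent_gt0.
by rewrite Ia ltry.
Qed.

Let r0 : r 0 = 0%R.
Proof. by rewrite /r primitive0_0 mulr0. Qed.

Let r1 : r 1 = t.
Proof.
have /eqP : (primitive0 (f_ent a) 1)%:E = 1 by rewrite (primitive0E int_f).
by rewrite eqe => /eqP e; rewrite /r e mulr1.
Qed.

Let r_continuous : {within `[0%R, 1%R], continuous r}.
Proof.
have c := primitive0_continuous int_f ler01; move=> z.
by apply: cvgM; [exact: cvg_cst|exact: c].
Qed.

Let r_is_derive y : y \in `]0%R, 1%R[ -> is_derive y 1%R r (t * f_ent a y)%R.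
Proof.
move=> y01; have cf : {for y, continuous (f_ent a)}.
  by apply: continuous_f_ent => //; move: y01; rewrite in_itv/= => /andP[-> /ltW].
have := primitive0_is_derive int_f y01 cf => d.
exact: is_deriveZ.
Qed.

Let r_incr x y : (0 <= x)%R -> (x < y)%R -> (y <= 1)%R -> (r x < r y)%R.
Proof.
move=> x0 xy y1.
apply: (@gtr0_derive1_lt_cc _ _ 0%R 1%R) => //.
- by move=> z z01; have := r_is_derive z01 => ?; exact: ex_derive.
- move=> z z01; have := r_is_derive z01 => ?.
  rewrite derive1E derive_val mulr_gt0 ?f_ent_gt0//.
  by move: z01; rewrite in_itv/= => /andP[/ltW -> /ltW ->].
- by rewrite in_itv/= x0; lra.
- by rewrite in_itv/= y1; lra.
Qed.

(** Inverse of the clock [r] on times between 0 and [t]. The default value 0 elsewhere makes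
    [threshold] vanish there, so that it is bounded and measurable on the whole line. *)
Let yinv s : R := xget 0%R [set y | (0 <= y <= 1)%R /\ r y = s].

Let yinv01 s : (0 <= yinv s <= 1)%R.
Proof.
rewrite /yinv; case: xgetP => [y _ [//]|_]; by rewrite lexx ler01.
Qed.

Let rK y : (0 <= y <= 1)%R -> yinv (r y) = y.
Proof.
move=> y01; rewrite /yinv; case: xgetP => [z _ [z01 rzy]|/(_ y)/=]; last by case.
apply/eqP; rewrite eq_le !leNgt; apply/andP; split; apply/negP => h.
- have := @r_incr y z; rewrite rzy ltxx => H; have : False; last by [].
  by apply/notF/H => //; [case/andP: y01|case/andP: z01].
- have := @r_incr z y; rewrite rzy ltxx => H; have : False; last by [].
  by apply/notF/H => //; [case/andP: z01|case/andP: y01].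
Qed.

Let yinvK s : (0 <= s <= t)%R -> r (yinv s) = s.
Proof.
move=> s0t; have [|y] := @IVT R r 0%R 1%R s ler01 r_continuous.
  by rewrite r0 r1 ge_min le_max; case/andP: s0t => -> ->; rewrite orbT.
by rewrite in_itv/= => y01 <-; rewrite rK.
Qed.

Let yinv_continuous s : s \in `]0%R, t[ -> {for s, continuous yinv}.
Proof.
have := @segment_can_le_continuous _ 0%R 1%R r yinv ler01 r_continuous.
rewrite r0 r1 => c; apply: within_continuous_continuous => //.
by apply: c => y; rewrite in_itv/=; exact: rK.
Qed.

Let measurable_yinv : measurable_fun [set: R] yinv.
Proof.
have -> : [set: R] = `[0%R, t]%classic `|` ~` `[0%R, t]%classic by rewrite setUv.
apply/measurable_funU => //; first exact: measurableC.
split.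
  apply: subspace_continuous_measurable_fun => //.
  have := @segment_can_le_continuous _ 0%R 1%R r yinv ler01 r_continuous.
  by rewrite r0 r1 => c; apply: c => y; rewrite in_itv/=; exact: rK.
apply: (@eq_measurable_fun _ _ _ _ _ (cst (0%R : R))) => [s|]; last exact: measurable_cst.
rewrite inE/= in_itv/= => s0t; symmetry.
rewrite /yinv; case: xgetP => // y _ [/andP[y0 y1] rys]; exfalso; apply: s0t.
rewrite -rys -[X in (X <= _)%R]r0 -r1; apply/andP; split.
- by have [-> //|y0'] := eqVneq y 0%R; apply/ltW/r_incr => //; rewrite lt_def y0'.
- by have [-> //|y1'] := eqVneq y 1%R; apply/ltW/r_incr => //; rewrite lt_def eq_sym y1'.
Qed.

(** Solves [(g_ent y + a) * W' = rho y + ln y * W] with [W 0 = 0], because [g_ent' = - ln]. *)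
Let W y : R := (L y * f_ent a y)%R.

Let W0 : W 0 = 0%R. Proof. by rewrite /W /L primitive0_0 mul0r. Qed.

Let W_bounds y : (0 <= y <= 1)%R -> (0 <= W y <= t * m / a * y)%R.
Proof.
move=> y01; have /andP[l0 lm] := L_bounds y01.
have f0 := f_ent_gt0 a0 y01; have fa := f_ent_le a0 y01.
apply/andP; split; first by apply: mulr_ge0 => //; exact: ltW.
by rewrite /W mulrAC; apply: ler_pM => //; exact: ltW.
Qed.

Definition threshold s : R := W (yinv s).

Lemma threshold_bounds s : (0 <= threshold s <= t * m / a)%R.
Proof.
have /andP[w0 wb] := W_bounds (yinv01 s).
rewrite w0/=; apply: le_trans wb _; rewrite -[leRHS]mulr1; apply: ler_wpM2l.
  by apply: divr_ge0 => //; exact: ltW.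
by case/andP: (yinv01 s).
Qed.

Lemma measurable_threshold : measurable_fun [set: R] threshold.
Proof.
apply: (@measurable_comp _ _ _ _ _ _ (`[0%R, 1%R]%classic : set R)) => //.
- by move=> _ [s _ <-] /=; rewrite in_itv/=; exact: yinv01.
- apply: measurable_funM; last by apply: measurable_funTS; exact: measurable_f_ent.
  apply: subspace_continuous_measurable_fun => //.
  exact: (primitive0_continuous int_rho ler01).
Qed.

Let h s : R := (expR s * Psi (threshold s))%R.

Let Psi_continuous v : {for v, continuous Psi}.
Proof.
apply/cvgrPdist_le => e e0; exists e => //= u.
by rewrite /ball_/= => /ltW; apply: le_trans; exact: PsiL.
Qed.

Let W_continuous y : y \in `]0%R, 1%R[ -> {for y, continuous W}.
Proof.
move=> y01; apply: cvgM.
  exact: (within_continuous_continuous ltr01 (primitive0_continuous int_rho ler01) y01).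
by apply: continuous_f_ent => //; move: y01; rewrite in_itv/= => /andP[-> /ltW].
Qed.

Let yinv_oo s : s \in `]0%R, t[ -> yinv s \in `]0%R, 1%R[.
Proof.
rewrite !in_itv/= => /andP[s0 st].
have s0t : (0 <= s <= t)%R by rewrite !ltW.
have rs := yinvK s0t; have /andP[y0 y1] := yinv01 s.
apply/andP; split; rewrite lt_def ?y0 ?y1 andbT; apply/eqP => e.
- by move: s0; rewrite -rs e r0 ltxx.
- by move: st; rewrite -rs -e r1 ltxx.
Qed.

Let h_continuous s : s \in `]0%R, t[ -> {for s, continuous h}.
Proof.
move=> s0t; apply: cvgM; first exact: continuous_expR.
apply: (@continuous_comp _ _ _ threshold Psi); last exact: Psi_continuous.
apply: (@continuous_comp _ _ _ yinv W); first exact: yinv_continuous.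
by apply: W_continuous; exact: yinv_oo.
Qed.

Let Psi0 v : (0 <= v)%R -> (0 <= Psi v)%R.
Proof.
move=> v0; rewrite -lee_fin PsiE//; apply: integral_ge0 => x _.
by rewrite lee_fin; case: ifP.
Qed.

Let h0 s : (0 <= h s)%R.
Proof.
apply: mulr_ge0; first exact: expR_ge0.
by apply: Psi0; case/andP: (threshold_bounds s).
Qed.

Lemma measurable_Psi_threshold : measurable_fun [set: R] (fun s => Psi (threshold s)).
Proof.
apply: (measurableT_comp (f := Psi)); last exact: measurable_threshold.
exact: continuous_measurable_fun.
Qed.

Let mh : measurable_fun [set: R] h.
Proof.
by apply: measurable_funM; [exact: measurable_expR|exact: measurable_Psi_threshold].
Qed.

Let int_h : mu.-integrable `[0%R, t] (EFin \o h).
Proof.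
apply: measurable_bounded_integrable => //.
- by rewrite /= lebesgue_measure_itv/= lte_fin t0 -EFinD ltry.
- exact: measurable_funTS.
exists (expR t * (Psi 0 + t * m / a))%R; split; first by rewrite num_real.
move=> M hM s /=; rewrite in_itv/= => /andP[s0 st].
rewrite ger0_norm// (le_trans _ (ltW hM))//.
apply: ler_pM; rewrite ?expR_ge0 ?ler_expR//.
  by apply: Psi0; case/andP: (threshold_bounds s).
have /andP[w0 wb] := threshold_bounds s.
have := PsiL (threshold s) 0%R; rewrite subr0 (ger0_norm w0) ler_norml.
move=> /andP[_]; rewrite lerBlDl => /le_trans; apply.
by rewrite lerD2l.
Qed.

Let H := primitive0 h.

Let integral_ltv c v : (0 <= c)%R -> (0 <= v)%R ->
  \int[mu]_(x in D) (if (x < v)%R then c else 0%R)%:E = (c * v)%:E.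
Proof.
move=> c0 v0; rewrite -[v in RHS]subr0 -(@integral_const_itv R c 0%R v v0).
rewrite -integral_itv_bndo_bndc; last exact: measurable_cst.
rewrite (_ : `[0%R, v[%classic = D `&` `]-oo, v[%classic); last first.
  apply/seteqP; split=> x; rewrite /D/= !in_itv/= ?andbT; first by move=> /andP[].
  by move=> [-> ->].
rewrite integral_mkcondr; apply: eq_integral => x _; rewrite patchE.
by rewrite mem_setE in_itv/=; case: ifP.
Qed.

(** Where [x < v], bound [kap z x] by [- ln z], elsewhere by [t * p x]. Adding [t] on the set
    [x < v] completes the second part to [t * Psi v]. At [z = y] and [v = W y] this is the
    differential inequality for [W] in the clock [r]. *)
Let rho_le z v : (z <= 1)%R -> (0 <= v)%R ->
  (rho z + t * v <= - ln z * v + t * Psi v)%R.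
Proof.
move=> z1 v0; have q0 : (0 <= - ln z)%R by rewrite oppr_ge0 ln_le0.
have t0' := ltW t0.
have mif (c : R) (f : R -> R) : measurable_fun [set: R] f ->
    measurable_fun D (fun x : R => (if (x < v)%R then c else f x)%:E).
  move=> mf; apply/measurable_funTS/measurable_EFinP.
  by apply: measurable_fun_ifT => //; exact: measurable_fun_ltr.
rewrite -lee_fin.
have mk : measurable_fun D (fun x => (kap z x)%:E).
  by apply/measurable_funTS/measurable_EFinP; exact: mkap.
have if0 (c : R) (f : R -> R) : (0 <= c)%R -> (forall x, 0 <= f x)%R ->
    forall x, D x -> 0 <= (if (x < v)%R then c else f x)%:E.
  by move=> c0 f0 x _; rewrite lee_fin; case: ifP.
have k0 x : D x -> 0 <= (kap z x)%:E by rewrite lee_fin kap0.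
have mt := mif t (cst 0%R) (measurable_cst _).
have mq := mif (- ln z)%R (cst 0%R) (measurable_cst _).
have m1 := mif 1%R p mp.
have -> : (rho z + t * v)%:E =
    \int[mu]_(x in D) ((kap z x)%:E + (if (x < v)%R then t else 0%R)%:E).
  by rewrite EFinD rhoE// -(integral_ltv t0' v0) ge0_integralD//; exact: if0.
have -> : (- ln z * v + t * Psi v)%:E = \int[mu]_(x in D)
    ((if (x < v)%R then - ln z else 0)%:E + t%:E * (if (x < v)%R then 1 else p x)%:E).
  rewrite EFinD [(t * Psi v)%:E]EFinM -(integral_ltv q0 v0) PsiE// -ge0_integralZl//=; last first.
    exact: if0.
  rewrite ge0_integralD//.
  - exact: if0.
  - by move=> x Dx; apply: mule_ge0; rewrite ?lee_fin//; exact: if0.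
  - exact: measurable_funeM.
apply: ge0_le_integral => //.
- by move=> x Dx; rewrite adde_ge0 ?k0//; exact: if0.
- exact: emeasurable_funD.
- by apply: emeasurable_funD => //; exact: measurable_funeM.
- move=> x _; rewrite -EFinM -!EFinD lee_fin.
  case: ifP => _; rewrite ?addr0 ?add0r ?kap_le// mulr1 lerD2r.
  by rewrite /kap ge_min lexx.
Qed.

Let f_is_derive y : y \in `]0%R, 1%R[ ->
  is_derive y 1%R (f_ent a) (ln y * f_ent a y ^+ 2)%R.
Proof.
rewrite in_itv/= => /andP[y0 y1].
have gz : (0 < g_ent y + a)%R.
  by rewrite addr_gt0// (lt_le_trans y0)// g_ent_ge// !ltW.
have dg : is_derive y 1%R (fun y => g_ent y + a)%R (- ln y)%R.
  have := is_derive1_ln y0 => dl.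
  rewrite /g_ent; apply: is_derive_eq; rewrite /GRing.scale/=.
  by field; rewrite gt_eqF.
have g0 : (g_ent y + a != 0)%R by rewrite gt_eqF.
have := @is_deriveV _ (fun y => g_ent y + a)%R y (- ln y)%R 1%R g0 dg.
move=> dV; apply: (is_derive_eq dV).
by rewrite /f_ent /GRing.scale/=; field.
Qed.

(* [0 <= Dfun y] is the subsolution property at time [r y]. *)
Let Dfun y : R := (H (r y) - expR (r y) * W y)%R.

Let r_oo y : y \in `]0%R, 1%R[ -> r y \in `]0%R, t[.
Proof.
rewrite !in_itv/= => /andP[y0 y1].
have h1 := r_incr (lexx 0%R) y0 (ltW y1); have h2 := r_incr (ltW y0) y1 (lexx 1%R).
by rewrite r0 in h1; rewrite r1 in h2; rewrite h1.
Qed.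

Let W_is_derive y : y \in `]0%R, 1%R[ ->
  is_derive y 1%R W (f_ent a y * (rho y + ln y * W y))%R.
Proof.
move=> y01; have d1 := f_is_derive y01.
have d2 := primitive0_is_derive int_rho y01 (rho_continuous y01).
apply: (is_derive_eq (is_deriveM d2 d1)).
by rewrite /W /L /GRing.scale/=; move: (primitive0 _ _) (rho _) => u v; ring.
Qed.

(** With [r' = t * f_ent a y] the factor [f_ent a y] comes out, and what is left in parentheses is
    nonnegative by [rho_le] at [v = W y]. *)
Let D_is_derive y : y \in `]0%R, 1%R[ -> is_derive y 1%R Dfun
  (expR (r y) * f_ent a y * (t * (Psi (W y) - W y) - rho y - ln y * W y))%R.
Proof.
move=> y01; have d1 := r_is_derive y01; have d2 := W_is_derive y01.
have dH := primitive0_is_derive int_h (r_oo y01) (h_continuous (r_oo y01)).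
have hE : h (r y) = (expR (r y) * Psi (W y))%R.
  by rewrite /h /threshold rK//; move: y01; rewrite in_itv/= => /andP[/ltW -> /ltW ->].
have dHr := @is_derive1_comp _ H r y _ _ dH d1.
have de := @is_derive1_comp _ expR r y _ _ (is_derive_expR (r y)) d1.
have deW := is_deriveM de d2.
apply: (is_derive_eq (is_deriveB dHr deW)).
by rewrite hE /= /GRing.scale/=; lra.
Qed.

Let D_nd y z : (0 < y)%R -> (y <= z)%R -> (z < 1)%R -> (Dfun y <= Dfun z)%R.
Proof.
move=> y0 yz z1.
have d x : x \in `]0%R, 1%R[ -> derivable Dfun x 1%R.
  by move=> x01; have := D_is_derive x01 => ?; exact: ex_derive.
have in01 x : (y <= x <= z)%R -> x \in `]0%R, 1%R[.
  by move=> /andP[yx xz]; rewrite in_itv/= (lt_le_trans y0 yx) (le_lt_trans xz z1).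
apply: (@ger0_derive1_le_cc _ Dfun y z) => //.
- move=> x; rewrite in_itv/= => /andP[/ltW yx /ltW xz].
  by apply: d; apply: in01; rewrite yx.
- move=> x; rewrite in_itv/= => /andP[/ltW yx /ltW xz].
  have x01 := in01 x; rewrite yx xz in x01; have {}x01 := x01 isT.
  have dx := D_is_derive x01; rewrite derive1E derive_val.
  move: x01; rewrite in_itv/= => /andP[/ltW x0 /ltW x1].
  have x01 : (0 <= x <= 1)%R by rewrite x0.
  apply: mulr_ge0; first by rewrite mulr_ge0 ?expR_ge0// ltW// f_ent_gt0.
  have /andP[w0 _] := W_bounds x01.
  have := rho_le x1 w0.
  by move: (rho x) (ln x) (W x) (Psi _) => u1 u2 u3 u4; lra.
- apply: derivable_within_continuous => x; rewrite in_itv/= => xyz.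
  by apply: d; apply: in01.
- by rewrite in_itv/= lexx.
- by rewrite in_itv/= lexx andbT.
Qed.

Let H_ge0 s : (0 <= s <= t)%R -> (0 <= H s)%R.
Proof.
move=> /andP[s0 st]; rewrite -lee_fin (primitive0E int_h)//.
by apply: integral_ge0 => x _; rewrite lee_fin.
Qed.

Let H_nd s : (0 <= s <= t)%R -> (H s <= H t)%R.
Proof.
move=> /andP[s0 st]; rewrite -lee_fin !(primitive0E int_h)//.
apply: ge0_subset_integral => //.
- exact/measurable_funTS/measurable_EFinP.
- by move=> x _; rewrite lee_fin.
- by apply: subset_itvl; rewrite bnd_simp.
Qed.

(** [Dfun] is nondecreasing, so it is enough to look near 0. There [H] is nonnegative and [W z] is
    at most a multiple of [z], whence [Dfun y >= - K * z] for all small [z]. *)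
Let D_ge0 y : (0 < y < 1)%R -> (0 <= Dfun y)%R.
Proof.
move=> /andP[y0 y1]; set K := (expR t * (t * m / a))%R.
have K0 : (0 <= K)%R.
  by rewrite mulr_ge0 ?expR_ge0// divr_ge0// ltW.
have Dz z : (0 < z)%R -> (z <= y)%R -> (- (K * z) <= Dfun y)%R.
  move=> z0 zy; apply: le_trans (D_nd z0 zy y1).
  have z01 : z \in `]0%R, 1%R[ by rewrite in_itv/= z0 (le_lt_trans zy).
  have := r_oo z01; rewrite in_itv/= => /andP[/ltW rz0 /ltW rzt].
  have Hz : (0 <= H (r z))%R by apply: H_ge0; rewrite rz0.
  have /andP[w0 wz] : (0 <= W z <= t * m / a * z)%R.
    by apply: W_bounds; rewrite ltW//= (le_trans zy)// ltW.
  suff : (expR (r z) * W z <= K * z)%R by rewrite /Dfun; lra.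
  rewrite /K -mulrA; apply: ler_pM; rewrite ?expR_ge0// ler_expR//.
rewrite leNgt; apply/negP => Dy.
(* Small enough that [K * z < - Dfun y], were [Dfun y] negative. *)
pose z := Num.min y (- Dfun y / (2 * (K + 1)))%R.
have K1 : (0 < 2 * (K + 1))%R by lra.
have z0 : (0 < z)%R by rewrite lt_min y0 divr_gt0// oppr_gt0.
have := Dz z z0; rewrite ge_min lexx => /(_ isT).
have : (z * (2 * (K + 1)) <= - Dfun y)%R.
  by rewrite -ler_pdivlMr// ge_min lexx orbT.
by move: (Dfun y) Dy z0 => d dlt; nra.
Qed.

Lemma threshold_subsolution s : (0 <= s <= t)%R ->
  (expR s * threshold s)%:E <=
  \int[mu]_(x in `[0%R, s]) (expR x * Psi (threshold x))%:E.
Proof.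
move=> s0t; have /andP[s0 st] := s0t; rewrite -(primitive0E int_h st) lee_fin -/H.
have /andP[y0 y1] := yinv01 s.
rewrite -{1 3}(yinvK s0t) /threshold; move: (yinv s) y0 y1 => y.
rewrite le_eqVlt => /predU1P[<- _|y0].
  by rewrite W0 mulr0 H_ge0// r0 lexx ltW.
rewrite le_eqVlt => /predU1P[->|y1]; last first.
  by have := @D_ge0 y; rewrite y0 y1 /Dfun subr_ge0; exact.
have cl (f : R -> R) : {within `[0%R, 1%R], continuous f} ->
    f x @[x --> (1%R : R)^'-] --> f 1%R.
  by move=> /(continuous_within_itvP _ ltr01)[].
(* The endpoint [y = 1], which is time [t], is a left limit: for [z < 1] the bound [H (r z)] is at
   most [H t]. *)
have cF : (expR (r y) * W y)%R @[y --> (1%R : R)^'-] --> (expR (r 1) * W 1)%R.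
  apply: cvgM.
    by apply: (cvg_comp _ _ (cl _ r_continuous)); exact: continuous_expR.
  apply: cvgM; first exact: cl _ (primitive0_continuous int_rho ler01).
  by apply: cvg_at_left_filter; apply: continuous_f_ent; rewrite ?ltr01/=.
apply: (cvgr_to_le cF); near=> z.
have z0 : (0 < z)%R by near: z; exact: nbhs_left_gt.
have z1 : (z < 1)%R by near: z; exact: nbhs_left_lt.
have z01 : z \in `]0%R, 1%R[ by rewrite in_itv/= z0.
have := @D_ge0 z; rewrite z0 z1 /Dfun subr_ge0 => /(_ isT) /le_trans; apply.
have := r_oo z01; rewrite in_itv/= => /andP[/ltW rz0 /ltW rzt].
by rewrite r1; apply: H_nd; rewrite rz0.
Unshelve. all: by end_near. Qed.

Lemma threshold_end : ((1 + a) * threshold t)%:E =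
  \int[mu]_(x in `[0%R, +oo[) (1 - expR (- (t * p x)))%:E.
Proof.
rewrite -L1; congr EFin; rewrite /threshold -r1 rK ?lexx ?ler01//.
rewrite /W /f_ent /g_ent ln1 mulr0 subr0.
have a1 : (1 + a != 0)%R by rewrite gt_eqF// addr_gt0.
by field.
Qed.

End subsolution.

(** * Arrivals and their history *)

(** Reflections preserve Lebesgue measure. This converts a waiting time into the time that remains
    after it. *)
Lemma ge0_integral_reflect (R : realType) (c : R) (f : R -> \bar R) :
  measurable_fun [set: R] f -> (forall x, 0 <= f x) ->
  \int[@lebesgue_measure R]_x f x = \int[@lebesgue_measure R]_x f (c - x)%R.
Proof.
move=> mf f0; pose phi : R -> measurableTypeR R := fun x => (c - x)%R.
have mphi : measurable_fun [set: R] phi by exact: measurable_funB.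
transitivity (\int[pushforward (@lebesgue_measure R) phi]_x f x).
  apply: eq_measure_integral => A mA _.
  apply: lebesgue_measure_unique => //= _ [[a b]] _ <-.
  rewrite /pushforward (_ : phi @^-1` _ = `[(c - b)%R, (c - a)%R[%classic); last first.
    by apply/seteqP; split => x /=; rewrite /phi !in_itv/=; lra.
  rewrite !lebesgue_measure_itv/= !lte_fin ltrD2l ltrN2; case: ifPn => // ab.
  by rewrite -!EFinB; congr EFin; lra.
by rewrite ge0_integral_pushforward.
Qed.

(** * Integration against densities and independent variables *)

Section density.
Context (R : realType).
Notation mu := (@lebesgue_measure R).
Variables (m : {measure set R -> \bar R}) (pdf : R -> R).
Hypothesis mpdf : measurable_fun [set: R] pdf.
Hypothesis pdf0 : forall x, (0 <= pdf x)%R.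
Hypothesis mE : forall A, measurable A -> m A = \int[mu]_(x in A) (pdf x)%:E.

Import HBNNSimple.

Lemma ge0_integral_density (f : R -> \bar R) :
  measurable_fun [set: R] f -> (forall x, 0 <= f x) ->
  \int[m]_x f x = \int[mu]_x (f x * (pdf x)%:E).
Proof.
move=> mf f0; pose f_ := nnsfun_approx measurableT mf.
have cf x : (f_ n x)%:E @[n --> \oo] --> f x.
  by apply: cvg_nnsfun_approx => // *; exact: f0.
have nd x : {homo (fun n => (f_ n x)%:E) : a b / (a <= b)%N >-> a <= b}.
  by move=> a b ab; rewrite lee_fin; exact/lefP/nd_nnsfun_approx.
have mp : measurable_fun [set: R] (fun x => (pdf x)%:E) by exact/measurable_EFinP.
have ind A : measurable A ->
    \int[m]_x (\1_A x)%:E = \int[mu]_x ((\1_A x)%:E * (pdf x)%:E).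
  move=> mA; rewrite integral_indic//= setIT mE// integral_mkcond.
  apply: eq_integral => x _; rewrite patchE indicE.
  by case: ifPn => _; rewrite ?mul1e ?mul0e.
have mind n r : measurable_fun [set: R] (fun x => (r * \1_(f_ n @^-1` [set r]) x)%:E).
  exact/measurable_EFinP/measurableT_comp.
have mi1 n r : measurable_fun [set: R] (fun x => (\1_(f_ n @^-1` [set r]) x : R)%:E).
  exact/measurable_EFinP/measurable_indic.
have mf_ n : measurable_fun [set: R] (fun x => (f_ n x)%:E) by exact/measurable_EFinP.
have sf n : \int[m]_x (f_ n x)%:E = \int[mu]_x ((f_ n x)%:E * (pdf x)%:E).
  under [LHS]eq_integral do rewrite fimfunE -fsumEFin//.
  rewrite [LHS]ge0_integral_fsum//; last 2 first.
  - by move=> r; exact/measurable_EFinP/measurableT_comp.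
  - by move=> r x _; rewrite EFinM nnfun_muleindic_ge0.
  under [RHS]eq_integral.
    move=> x _; rewrite fimfunE -fsumEFin// ge0_mule_fsuml; last first.
      by move=> r; rewrite EFinM nnfun_muleindic_ge0.
    over.
  rewrite [RHS]ge0_integral_fsum//; last 2 first.
  - by move=> r; apply: emeasurable_funM => //; exact: mind.
  - move=> r x _; apply: mule_ge0; last by rewrite lee_fin.
    by rewrite EFinM nnfun_muleindic_ge0.
  apply: eq_fsbigr => r _.
  have [r0|r0] := ltP r 0%R.
    rewrite preimage_nnfun0//.
    by rewrite !integral0_eq// => x _; rewrite indic0/= mulr0 ?mul0e.
  under eq_integral do rewrite EFinM.
  under [RHS]eq_integral do rewrite EFinM -muleA.
  rewrite !ge0_integralZl//=.
  - by rewrite ind.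
  - exact: (emeasurable_funM (mi1 n r) mp).
  - by move=> x _; rewrite mule_ge0 ?lee_fin.
transitivity (limn (fun n => \int[m]_x (f_ n x)%:E)).
  rewrite -monotone_convergence//.
  - by apply: eq_integral => x _; apply/esym/cvg_lim => //; exact: cf.
  - by move=> n x _; rewrite lee_fin.
rewrite (_ : (fun n => _) = (fun n => \int[mu]_x ((f_ n x)%:E * (pdf x)%:E))); last first.
  by apply/funext => n; exact: sf.
rewrite -monotone_convergence//.
- apply: eq_integral => x _; apply/cvg_lim => //.
  by apply: cvgeZr.
- by move=> n; exact: (emeasurable_funM (mf_ n) mp).
- by move=> n x _; rewrite mule_ge0 ?lee_fin.
- by move=> x _ a b ab; apply: lee_wpmul2r; [rewrite lee_fin|exact: nd].
Qed.

End density.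

(** In [A], both sides are finite measures of total mass [P E]; they agree on a pi-system, hence on
    the sigma-algebra it generates. *)
Lemma pi_system_indep d (T : measurableType d) (R : realType)
    (P : probability T R) (G : set (set T)) (E : set T) :
  G `<=` measurable -> setI_closed G -> G setT -> measurable E ->
  (forall A, G A -> P (A `&` E) = P A * P E) ->
  forall A, <<s G >> A -> P (A `&` E) = P A * P E.
Proof.
move=> Gm GI GT mE GE A sA.
have PE0 : (0 <= fine (P E))%R by exact: fine_ge0.
pose m2 := mscale (NngNum PE0) P.
have := @g_sigma_algebra_measure_unique _ R T G Gm (fun=> setT) (fun=> GT) _
  (mrestr P mE) m2 GI.
rewrite bigcup_const// => /(_ erefl) H.
have m2E B : m2 B = P B * P E.
  by rewrite /m2 /mscale/= fineK ?fin_num_measure// muleC.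
rewrite -m2E; apply: H => //.
- by move=> B GB; apply: eq_trans (esym (m2E B)); exact: GE.
- move=> _; apply: (@le_lt_trans _ _ 1); last exact: ltry.
  by apply: probability_le1; exact: measurableI.
Qed.

Section integral_indep.
Context d (T : measurableType d) (R : realType) (P : probability T R).
Variables (G : set (set T)) (Y : {RV P >-> R}).
Hypothesis Gm : G `<=` measurable.
Hypothesis ind : forall A C, <<s G >> A -> measurable C ->
  P (A `&` Y @^-1` C) = P A * P (Y @^-1` C).

Local Notation TG := (g_sigma_algebraType G).

(** The identity, seen as a random element of the sample space with the coarser sigma-algebra of
    [G], is independent of [Y], so their joint law is a product and Tonelli applies. In this way [f]
    may depend on the past without naming its coordinates. *)
Lemma integral_indep (f : TG * R -> \bar R) :
  measurable_fun [set: TG * R] f -> (forall z, 0 <= f z) ->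
  \int[P]_w f (w, Y w) = \int[P]_w \int[distribution P Y]_y f (w, y).
Proof.
move=> mf f0.
have sGm : <<s G >> `<=` measurable by exact: smallest_sub (@sigma_algebra_measurable _ T) Gm.
have mid : measurable_fun [set: T] (id : T -> TG).
  by move=> _ A mA; rewrite setTI; exact: sGm.
have mpair : measurable_fun [set: T] (fun w => (w : TG, Y w)).
  by apply: measurable_fun_pair.
pose Z : {mfun T >-> TG} := HB.pack (id : T -> TG) (isMeasurableFun.Build _ _ _ _ _ mid).
pose ZY : {mfun T >-> (TG * R)%type} :=
  HB.pack (fun w => (w : TG, Y w)) (isMeasurableFun.Build _ _ _ _ _ mpair).
transitivity (\int[distribution P ZY]_z f z); first by rewrite ge0_integral_distribution.
transitivity (\int[distribution P Z \x distribution P Y]_z f z).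
  apply: eq_measure_integral => A mA _.
  apply: esym; apply: product_measure_unique; last exact: mA.
  by move=> B C mB mC; exact: (@ind B C mB mC).
rewrite fubini_tonelli1// ge0_integral_distribution//.
- exact: measurable_fun_fubini_tonelli_F.
- by move=> w; apply: integral_ge0 => y _.
Qed.

End integral_indep.

Section rectangles.
Context d (T : measurableType d) (R : realType) (P : probability T R).

(** A pi-system generating the joint sigma-algebra of the first [i] variables of [Y] and the first
    [j] of [Z]. *)
Definition rects (Y Z : nat -> T -> R) (i j : nat) : set (set T) :=
  [set A | exists B C : nat -> set R,
    [/\ forall n, measurable (B n), forall n, measurable (C n) &
        A = (\bigcap_(n < i) Y n @^-1` B n) `&` (\bigcap_(n < j) Z n @^-1` C n)]].

Lemma rectsC (Y Z : nat -> T -> R) i j : rects Y Z i j = rects Z Y j i.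
Proof.
by apply/seteqP; split => A [B [C [mB mC ->]]]; exists C, B; split => //; rewrite setIC.
Qed.

Lemma rects_setI_closed (Y Z : nat -> T -> R) i j : setI_closed (rects Y Z i j).
Proof.
move=> A A' [B [C [mB mC ->]]] [B' [C' [mB' mC' ->]]].
exists (fun n => B n `&` B' n), (fun n => C n `&` C' n); split.
- by move=> n; exact: measurableI.
- by move=> n; exact: measurableI.
- by rewrite setIACA -!bigcapI.
Qed.

Lemma rects_setT (Y Z : nat -> T -> R) i j : rects Y Z i j setT.
Proof.
exists (fun=> setT), (fun=> setT); split => //.
by rewrite !bigcapT ?setIT// => n _; rewrite preimage_setT.
Qed.

Lemma rects_preimage (Y Z : nat -> T -> R) i j k (D : set R) : (k < i)%N ->
  measurable D -> rects Y Z i j (Y k @^-1` D).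
Proof.
move=> ki mD; exists (fun n => if n == k then D else setT), (fun=> setT); split => //.
  by move=> n; case: ifP.
rewrite [X in _ `&` X]bigcapT ?setIT; last by move=> n _; rewrite preimage_setT.
apply/seteqP; split => w /=.
  by move=> Dw n _ /=; case: eqP => // ->.
by move=> /(_ k ki) /=; rewrite eqxx.
Qed.

Lemma measurable_fun_g_sigma (G : set (set T)) (f : T -> R) :
  (forall D, measurable D -> <<s G >> (f @^-1` D)) <->
  measurable_fun [set: g_sigma_algebraType G] (f : g_sigma_algebraType G -> R).
Proof.
split=> [fG _ D mD|mf D mD]; first by rewrite setTI; exact: fG.
by rewrite -[_ @^-1` _]setTI; exact: mf.
Qed.

Lemma sigma_seq_bigcap (Y : nat -> T -> R) (B : nat -> set R) i :
  (forall n, measurable (B n)) -> sigma_seq Y (\bigcap_(n < i) Y n @^-1` B n).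
Proof.
move=> mB.
apply: (@bigcap_measurableType _ (g_sigma_algebraType
  (\bigcup_(k in [set: nat]) preimage_set_system setT (Y k) measurable))) => k _.
apply: sub_sigma_algebra; exists k => //; exists (B k) => //.
by rewrite setTI.
Qed.

Lemma bigcap_ltS (F : nat -> set T) i :
  \bigcap_(n < i.+1) F n = (\bigcap_(n < i) F n) `&` F i.
Proof. by rewrite !bigcap_mkord big_ord_recr. Qed.

Lemma mutually_independent_ltS (Y : nat -> T -> R) (B : nat -> set R) i :
  mutually_independent P Y -> (forall n, measurable (B n)) ->
  P (\bigcap_(n < i.+1) Y n @^-1` B n) =
  P (\bigcap_(n < i) Y n @^-1` B n) * P (Y i @^-1` B i).
Proof.
move=> mi mB; pose J k := [fset n | n in iota 0 k]%fset.
have inJ k n : (n \in J k) = (n < k)%N by rewrite /J !inE/= mem_iota add0n.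
have JE k : [set` J k] = `I_k by apply/seteqP; split => n /=; rewrite inJ.
have JS k : J k.+1 = (k |` J k)%fset.
  by apply/fsetP => n; rewrite finmap.in_fset1U !inJ ltnS leq_eqVlt.
have hS := mi (J i.+1) B mB; have hi := mi (J i) B mB; rewrite !JE in hS hi.
apply: (eq_trans hS); rewrite JS big_fsetU1 ?inJ ?ltnn// muleC.
by congr (_ * _); exact: esym hi.
Qed.

(** It suffices to treat rectangles. There independence of the sequences separates the [Y] block
    from the [Z] block, and [Y i] then splits off the [Y] block by mutual independence. *)
Lemma indep_next (Y Z : nat -> T -> R) i j A (D : set R) :
  (forall n, measurable_fun [set: T] (Y n)) ->
  (forall n, measurable_fun [set: T] (Z n)) ->
  mutually_independent P Y ->
  (forall A B, sigma_seq Y A -> sigma_seq Z B -> P (A `&` B) = P A * P B) ->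
  <<s rects Y Z i j >> A -> measurable D ->
  P (A `&` Y i @^-1` D) = P A * P (Y i @^-1` D).
Proof.
move=> mY mZ miY YZ sA mD.
have mYB k (B : set R) : measurable B -> measurable (Y k @^-1` B).
  by move=> mB; rewrite -[_ @^-1` _]setTI; exact: mY.
have mZB k (B : set R) : measurable B -> measurable (Z k @^-1` B).
  by move=> mB; rewrite -[_ @^-1` _]setTI; exact: mZ.
apply: (pi_system_indep (G := rects Y Z i j)) sA.
- move=> _ [B [C [mB mC ->]]]; apply: measurableI.
    by apply: bigcap_measurableType => k _; exact: mYB.
  by apply: bigcap_measurableType => k _; exact: mZB.
- exact: rects_setI_closed.
- exact: rects_setT.
- exact: mYB.
move=> _ [B [C [mB mC ->]]].
(* Placing [D] at index [i] makes the event about [Y i] the last factor of a block of length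
   [i.+1]. *)
pose B' n := if n == i then D else B n.
have mB' n : measurable (B' n) by rewrite /B'; case: ifP.
have BB' : \bigcap_(n < i) Y n @^-1` B n = \bigcap_(n < i) Y n @^-1` B' n.
  by apply: eq_bigcapr => n /= ni; rewrite /B' ltn_eqF.
have B'i : Y i @^-1` D = Y i @^-1` B' i by rewrite /B' eqxx.
rewrite setIAC BB' {1}B'i -bigcap_ltS.
rewrite YZ; [|exact: sigma_seq_bigcap|exact: sigma_seq_bigcap].
rewrite YZ; [|exact: sigma_seq_bigcap|exact: sigma_seq_bigcap].
by rewrite (mutually_independent_ltS i miY mB') -B'i muleAC.
Qed.

End rectangles.

Section arrivals.
Context d (T : measurableType d) (R : realType) (P : probability T R).
Variables (X0 : {RV P >-> R}) (X S : nat -> {RV P >-> R}).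
Hypothesis iid : iid_as X0 X.
Hypothesis arr : poisson_arrivals 1%R S.
Hypothesis ind : independent_seqs P (fun k => X k.+1) (fun k => S k.+1).

(** [gap k] ends at arrival [k.+1], so the gaps of index below [k] determine the arrival times up to
    [S k]. Unlike the arrival times, the gaps are independent. *)
Definition gap k : {RV P >-> R} := (S k.+1 - S k)%R.

Let XS k : T -> R := X k.+1.
Let gapf k : T -> R := gap k.

Lemma gapE k w : gap k w = (S k.+1 w - S k w)%R.
Proof. by []. Qed.

Let S0 w : S 0%N w = 0%R. Proof. by case: arr => + _ _; exact. Qed.

Let mXS k : measurable_fun [set: T] (XS k). Proof. exact: measurable_funPT. Qed.

Let mgap k : measurable_fun [set: T] (gapf k). Proof. exact: measurable_funPT. Qed.

Let cross A B : sigma_seq XS A -> sigma_seq gapf B -> P (A `&` B) = P A * P B.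
Proof.
move=> sA sB; apply: ind => //; move: B sB.
apply: smallest_sub; first exact: smallest_sigma_algebra.
pose G := \bigcup_(k in [set: nat]) preimage_set_system setT (S k.+1) measurable.
have mS k : measurable_fun [set: g_sigma_algebraType G] (S k : g_sigma_algebraType G -> R).
  case: k => [|k].
    rewrite (_ : (S 0%N : T -> R) = cst 0%R); first exact: measurable_cst.
    by apply/funext => w; exact: S0.
  apply/measurable_fun_g_sigma => D mD; apply: sub_sigma_algebra; exists k => //.
  by exists D => //; rewrite setTI.
move=> _ [k _ [D mD <-]]; rewrite setTI.
apply: (measurable_fun_g_sigma G (gapf k)).2 => //.
exact: (measurable_funB (mS k.+1) (mS k)).
Qed.

Let miX : mutually_independent P XS. Proof. by case: iid. Qed.

Let miG : mutually_independent P gapf. Proof. by case: arr. Qed.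

Lemma indep_next_X i j A (D : set R) : <<s rects XS gapf i j >> A -> measurable D ->
  P (A `&` X i.+1 @^-1` D) = P A * P (X i.+1 @^-1` D).
Proof. by move=> sA mD; apply: (@indep_next _ _ _ _ XS gapf i j). Qed.

Lemma indep_next_gap i j A (D : set R) : <<s rects XS gapf i j >> A -> measurable D ->
  P (A `&` gap j @^-1` D) = P A * P (gap j @^-1` D).
Proof.
rewrite rectsC => sA mD; apply: (@indep_next _ _ _ _ gapf XS j i) => //.
by move=> B C sB sC; rewrite setIC muleC; exact: cross.
Qed.

Lemma measurable_arrival_rects i j k : (k <= j)%N ->
  measurable_fun [set: g_sigma_algebraType (rects XS gapf i j)]
    (S k : g_sigma_algebraType (rects XS gapf i j) -> R).
Proof.
elim: k => [_|k IH kj].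
  rewrite (_ : (S 0%N : T -> R) = cst 0%R); first exact: measurable_cst.
  by apply/funext => w; exact: S0.
rewrite (_ : (S k.+1 : T -> R) = (S k : T -> R) \+ gapf k)%R; last first.
  by apply/funext => w /=; rewrite /gapf gapE addrC subrK.
apply: measurable_funD; first exact: IH (ltnW kj).
apply/measurable_fun_g_sigma => D mD; apply: sub_sigma_algebra.
by rewrite rectsC; exact: rects_preimage.
Qed.

Definition history_gen k : set (set T) :=
  \bigcup_(j in [set j | (1 <= j <= k)%N]) g_sigma_preimageU (X j) (S j).

Definition history k : set (set T) := <<s history_gen k >>.

(** The case [j = k.+1] is the one needed to integrate out [X k.+1] with the gap preceding it held
    fixed. *)
Lemma history_rects k j A : (k <= j)%N -> history k A -> <<s rects XS gapf k j >> A.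
Proof.
move=> kj; move: A; apply: smallest_sub; first exact: smallest_sigma_algebra.
move=> A [n /= /andP[n0 nk]]; move: A.
apply: smallest_sub; first exact: smallest_sigma_algebra.
rewrite subUset; split => _ [D mD <-]; rewrite setTI.
- apply: sub_sigma_algebra; case: n n0 nk => // n _ nk.
  exact: (@rects_preimage _ _ _ XS gapf).
- apply: (measurable_fun_g_sigma _ _).2 => //.
  by apply: measurable_arrival_rects; exact: leq_trans nk kj.
Qed.

Lemma rects_measurable i j : rects XS gapf i j `<=` measurable.
Proof.
move=> _ [B [C [mB mC ->]]]; apply: measurableI.
  apply: bigcap_measurableType => k _; rewrite -[_ @^-1` _]setTI; exact: mXS.
by apply: bigcap_measurableType => k _; rewrite -[_ @^-1` _]setTI; exact: mgap.
Qed.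

Lemma history_measurable k A : history k A -> measurable A.
Proof.
move=> /(history_rects (leqnn k)).
by move: A; apply: smallest_sub; [exact: sigma_algebra_measurable|exact: rects_measurable].
Qed.

End arrivals.

Section arrival_step.
Context d (T : measurableType d) (R : realType) (P : probability T R).
Variables (X0 : {RV P >-> R}) (X S : nat -> {RV P >-> R}).
Hypothesis iid : iid_as X0 X.
Hypothesis arr : poisson_arrivals 1%R S.
Hypothesis ind : independent_seqs P (fun k => X k.+1) (fun k => S k.+1).
Notation mu := (@lebesgue_measure R).
Notation law := (distribution P X0).

Let XS k : T -> R := X k.+1.
Let gapf k : T -> R := gap S k.

Lemma integral_law k (f : R -> \bar R) :
  \int[distribution P (X k.+1)]_x f x = \int[law]_x f x.
Proof.
apply: eq_measure_integral => A mA _.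
by case: iid => _ /(_ k.+1 isT); apply.
Qed.

Lemma integral_gap k (f : R -> \bar R) :
  measurable_fun [set: R] f -> (forall u, 0 <= f u) ->
  \int[distribution P (gap S k)]_u f u =
  \int[mu]_(u in `[0%R, +oo[) (f u * (expR (- u))%:E).
Proof.
move=> mf f0.
have pdf0 (u : R) : (0 <= exponential_pdf 1 u)%R by exact: exponential_pdf_ge0.
have law_gap A : measurable A ->
    distribution P (gap S k) A = \int[mu]_(u in A) (exponential_pdf 1 u)%:E.
  by move=> mA; case: arr => _ _ /(_ k A mA).
apply: (eq_trans (ge0_integral_density (measurable_exponential_pdf 1%R) pdf0 law_gap mf f0)).
rewrite [RHS]integral_mkcond; apply: eq_integral => u _; rewrite patchE.
case: ifPn => u0.
  rewrite exponential_pdfE; first by rewrite mul1r mulN1r.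
  by move: u0; rewrite inE/= in_itv/= andbT.
by rewrite /exponential_pdf patchE ifF ?mule0//; exact/negbTE.
Qed.

(** Conditional expectation given the first [k] arrivals, in two applications of [integral_indep]:
    first [X k.+1] given [k] values and [k.+1] gaps, then [gap S k] given [k] values and [k]
    gaps. *)
Lemma arrival_step k A (h : R * R -> \bar R) :
  history X S k A -> measurable_fun [set: R * R] h -> (forall z, 0 <= h z) ->
  \int[P]_(w in A) h (X k.+1 w, S k.+1 w) =
  \int[P]_(w in A) \int[mu]_(u in `[0%R, +oo[)
    ((\int[law]_x h (x, (S k w + u)%R)) * (expR (- u))%:E).
Proof.
move=> hA mh h0.
have mA := history_measurable arr hA.
pose h2 s := \int[law]_x h (x, s).
have h20 s : 0 <= h2 s by exact: integral_ge0.
have mh2 : measurable_fun [set: R] h2.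
  exact: (measurable_fun_fubini_tonelli_G (m1 := law) h mh h0).
have ind0 w : 0 <= (\1_A w : R)%:E by rewrite lee_fin.
transitivity (\int[P]_w ((\1_A w)%:E * h (X k.+1 w, S k.+1 w))).
  rewrite [LHS]integral_mkcond; apply: eq_integral => w _; rewrite patchE indicE.
  by case: ifP => _; rewrite ?mul1e ?mul0e.
pose G1 := rects XS gapf k k.+1.
have mA1 : measurable_fun [set: g_sigma_algebraType G1] (\1_A : g_sigma_algebraType G1 -> R).
  by apply: measurable_indic; exact: (history_rects arr (leqnSn k) hA).
have mS1 := measurable_arrival_rects arr (X := X) (i := k) (leqnn k.+1).
rewrite (@integral_indep _ T R P G1 (X k.+1) _ _
  (fun z => (\1_A z.1)%:E * h (z.2, S k.+1 z.1)))//; last 4 first.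
- exact: rects_measurable.
- exact: (indep_next_X iid arr ind).
- apply: emeasurable_funM.
    by apply/measurable_EFinP; apply: (measurableT_comp mA1).
  apply: (measurableT_comp mh); apply: measurable_fun_pair => //.
  by apply: (measurableT_comp mS1).
- by move=> z; exact: mule_ge0.
transitivity (\int[P]_w ((\1_A w)%:E * h2 (S k w + gap S k w)%R)).
  apply: eq_integral => w _; rewrite gapE [(S k w + _)%R]addrC subrK.
  rewrite integral_law/= ge0_integralZl//=.
  by apply: (measurableT_comp mh); exact: measurable_fun_pair.
pose G2 := rects XS gapf k k.
have mA2 : measurable_fun [set: g_sigma_algebraType G2] (\1_A : g_sigma_algebraType G2 -> R).
  by apply: measurable_indic; exact: (history_rects arr (leqnn k) hA).
have mS2 := measurable_arrival_rects arr (X := X) (i := k) (leqnn k).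
rewrite (@integral_indep _ T R P G2 (gap S k) _ _
  (fun z => (\1_A z.1)%:E * h2 (S k z.1 + z.2)%R))//; last 4 first.
- exact: rects_measurable.
- exact: (indep_next_gap arr ind).
- apply: emeasurable_funM.
    by apply/measurable_EFinP; apply: (measurableT_comp mA2).
  apply: (measurableT_comp mh2); apply: measurable_funD => //.
  by apply: (measurableT_comp mS2).
- by move=> z; exact: mule_ge0.
rewrite [RHS]integral_mkcond; apply: eq_integral => w _.
have mh2w : measurable_fun [set: R] (fun u => h2 (S k w + u)%R).
  by apply: (measurableT_comp mh2); exact: measurable_funD.
rewrite /= ge0_integralZl//= patchE indicE; case: ifP => _; last by rewrite mul0e.
by rewrite mul1e integral_gap.
Qed.

End arrival_step.

(** * Threshold rules *)

Lemma indic_congr (R : realType) (U V : Type) (A : set U) (B : set V) (x : U) (y : V) :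
  (A x <-> B y) -> \1_A x = \1_B y :> R.
Proof.
move=> AB; rewrite !indicE.
suff -> : (x \in A) = (y \in B) by [].
by apply/idP/idP; rewrite !inE => /AB.
Qed.

Section clipped_step.
Context d (T : measurableType d) (R : realType) (P : probability T R).
Variables (X0 : {RV P >-> R}) (X S : nat -> {RV P >-> R}).
Hypothesis iid : iid_as X0 X.
Hypothesis arr : poisson_arrivals 1%R S.
Hypothesis ind : independent_seqs P (fun k => X k.+1) (fun k => S k.+1).
Notation mu := (@lebesgue_measure R).
Notation law := (distribution P X0).
Variable t : R.

(** Arrival times may be negative on a null event; the lower bound keeps the remaining time
    [t - S k w] between 0 and [t]. *)
Definition in_time k : set T := [set w | (0 <= S k w <= t)%R].

(** The expectation of [Q] at the time remaining after the next arrival, if that arrival comes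
    within [s]: the integral of [exp (- u) * Q (s - u)] with [x = s - u]. *)
Definition discounted (Q : R -> \bar R) (s : R) : \bar R :=
  (expR (- s))%:E * \int[mu]_(x in `[0%R, s]) ((expR x)%:E * Q x).

(** [arrival_step] for a payoff set to 0 after time [t], followed by the reflection of the waiting
    time at [u0 = t - S k w]. *)
Lemma clipped_step k A (q : R * R -> \bar R) :
  history X S k A -> A `<=` in_time k ->
  measurable_fun [set: R * R] q -> (forall z, 0 <= q z) ->
  \int[P]_(w in A) (q (X k.+1 w, (t - S k.+1 w)%R) * (\1_(in_time k.+1) w)%:E) =
  \int[P]_(w in A) discounted (fun s => \int[law]_x q (x, s)) (t - S k w)%R.
Proof.
move=> hA Ak mq q0.
pose Q s := \int[law]_x q (x, s).
have Q0 s : 0 <= Q s by exact: integral_ge0.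
have mQ : measurable_fun [set: R] Q.
  exact: (measurable_fun_fubini_tonelli_G (m1 := law) q mq q0).
pose h (z : R * R) := q (z.1, (t - z.2)%R) * (\1_(`[0%R, t]%classic : set R) z.2)%:E.
have h0 z : 0 <= h z by rewrite mule_ge0 ?lee_fin.
have mh : measurable_fun [set: R * R] h.
  apply: emeasurable_funM.
    apply: (measurableT_comp mq); apply: measurable_fun_pair => //.
    exact: measurable_funB.
  by apply/measurable_EFinP; apply: (measurableT_comp (measurable_indic _)).
transitivity (\int[P]_(w in A) h (X k.+1 w, S k.+1 w)).
  apply: eq_integral => w _; rewrite /h/=.
  suff -> : (\1_(in_time k.+1) w = \1_(`[0%R, t]%classic : set R) (S k.+1 w) :> R)%R by [].
  by apply: indic_congr; rewrite /in_time/= in_itv.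
rewrite (arrival_step iid arr ind hA mh h0).
apply: eq_integral => w; rewrite inE => /Ak; rewrite /in_time/= => /andP[S0 St].
set s := S k w; pose u0 := (t - s)%R.
pose F (x : R) : \bar R := (\1_(`[0%R, u0]%classic : set R) x)%:E * (Q x * (expR (x - u0))%:E).
have F0 x : 0 <= F x by rewrite !mule_ge0 ?lee_fin ?expR_ge0.
have mF : measurable_fun [set: R] F.
  apply: emeasurable_funM; first exact/measurable_EFinP.
  apply: emeasurable_funM => //; apply/measurable_EFinP.
  by apply: measurableT_comp => //; exact: measurable_funB.
transitivity (\int[mu]_x F (u0 - x)%R).
  rewrite integral_mkcond; apply: eq_integral => x _; rewrite patchE.
  rewrite /F/h/=.
  have -> : (u0 - x - u0 = - x)%R by rewrite addrAC subrr add0r.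
  have -> : (t - (s + x) = u0 - x)%R by rewrite opprD addrA.
  rewrite mem_setE in_itv/= andbT; case: ifPn => x0; last first.
    rewrite indicE memNset ?mul0e//= in_itv/= => /andP[_].
    by rewrite gerBl; exact/negP.
  rewrite ge0_integralZr//; last first.
    by apply: (measurableT_comp mq); exact: measurable_fun_pair.
  rewrite [RHS]muleA [X in _ = X * _]muleC; congr (_ * _); congr (_ * _); congr EFin.
  apply: indic_congr; rewrite /= !in_itv/= /u0; move: x0 S0; rewrite -/s.
  move=> x0 S0; split => /andP[A1 A2]; apply/andP; lra.
rewrite -(ge0_integral_reflect _ mF F0).
pose D : set R := `[0%R, u0]%classic.
have mD : measurable D by exact: measurable_itv.
have E0 x : D x -> 0 <= (expR x)%:E * Q x.
  by move=> _; apply: mule_ge0; [rewrite lee_fin expR_ge0|exact: Q0].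
have mE : measurable_fun D (fun x => (expR x)%:E * Q x).
  apply: emeasurable_funM; last exact: measurable_funTS.
  by apply/measurable_EFinP; exact: measurable_funTS.
rewrite /discounted.
have e0 : 0 <= (expR (- u0))%:E :> \bar R by rewrite lee_fin expR_ge0.
apply: (eq_trans _ (ge0_integralZl mu mD mE E0 e0)).
rewrite [RHS]integral_mkcond; apply: eq_integral => x _; rewrite patchE /F indicE.
case: ifPn => _; last by rewrite mul0e.
by rewrite mul1e muleA -EFinM -expRD addrC muleC.
Qed.

End clipped_step.

Section history.
Context d (T : measurableType d) (R : realType) (P : probability T R).
Variables (X S : nat -> {RV P >-> R}).

Lemma history_mono i j : (i <= j)%N -> history X S i `<=` history X S j.
Proof.
move=> ij; apply: sub_smallest2r; first exact: smallest_sigma_algebra.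
by move=> A [k /= /andP[k1 ki] kA]; exists k => //=; rewrite k1 (leq_trans ki).
Qed.

Lemma measurable_history_X j k : (1 <= j <= k)%N ->
  measurable_fun [set: g_sigma_algebraType (history_gen X S k)]
    (X j : g_sigma_algebraType (history_gen X S k) -> R).
Proof.
move=> jk; apply/measurable_fun_g_sigma => D mD; apply: sub_sigma_algebra.
exists j => //; apply: sub_sigma_algebra; left; exists D => //; exact: setTI.
Qed.

Lemma measurable_history_S j k : (1 <= j <= k)%N ->
  measurable_fun [set: g_sigma_algebraType (history_gen X S k)]
    (S j : g_sigma_algebraType (history_gen X S k) -> R).
Proof.
move=> jk; apply/measurable_fun_g_sigma => D mD; apply: sub_sigma_algebra.
exists j => //; apply: sub_sigma_algebra; right; exists D => //; exact: setTI.
Qed.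

Lemma history_XS k (B : set (R * R)) : measurable B ->
  history X S k.+1 ((fun w => (X k.+1 w, S k.+1 w)) @^-1` B).
Proof.
move=> mB.
have kk : (1 <= k.+1 <= k.+1)%N by rewrite leqnn.
have := measurable_fun_pair (measurable_history_X kk) (measurable_history_S kk).
by move=> /(_ measurableT _ mB); rewrite setTI.
Qed.

Lemma history_setT k : history X S k setT.
Proof.
exact: (@measurableT _ (g_sigma_algebraType (history_gen X S k))).
Qed.

Lemma history_setI k A B : history X S k A -> history X S k B ->
  history X S k (A `&` B).
Proof.
exact: (@measurableI _ (g_sigma_algebraType (history_gen X S k))).
Qed.

Lemma history_setD k A B : history X S k A -> history X S k B ->
  history X S k (A `\` B).
Proof.
exact: (@measurableD _ (g_sigma_algebraType (history_gen X S k))).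
Qed.

End history.

Section threshold_rule.
Context d (T : measurableType d) (R : realType) (P : probability T R).
Variables (X0 : {RV P >-> R}) (X S : nat -> {RV P >-> R}).
Hypothesis iid : iid_as X0 X.
Hypothesis arr : poisson_arrivals 1%R S.
Hypothesis ind : independent_seqs P (fun k => X k.+1) (fun k => S k.+1).
Notation law := (distribution P X0).
Variable t : R.
Hypothesis t0 : (0 <= t)%R.
Variable stop : set (R * R).
Hypothesis mstop : measurable stop.

Definition stopped k : set T := [set w | stop (X k w, (t - S k w)%R)].

(** Still in play after arrival [k]: every arrival so far was in time and was declined. The event
    [hit k] below is acceptance at arrival [k.+1]. *)
Fixpoint surv k : set T :=
  if k is k'.+1 then surv k' `&` (in_time S t k `\` stopped k) else setT.

Definition hit k : set T := surv k `&` (in_time S t k.+1 `&` stopped k.+1).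

Lemma history_in_time k : history X S k.+1 (in_time S t k.+1).
Proof.
rewrite (_ : in_time S t k.+1 =
  (fun w => (X k.+1 w, S k.+1 w)) @^-1` [set z | z.2 \in `[0%R, t]]).
  apply: history_XS; rewrite -[X in measurable X]setTI.
  exact: (@measurable_snd _ _ R R measurableT _ (measurable_itv `[0%R, t])).
by apply/seteqP; split => w /=; rewrite in_itv.
Qed.

Lemma history_stopped k : history X S k.+1 (stopped k.+1).
Proof.
rewrite (_ : stopped k.+1 = (fun w => (X k.+1 w, S k.+1 w)) @^-1`
  ((fun z : R * R => (z.1, (t - z.2)%R)) @^-1` stop))//.
apply: history_XS; rewrite -[X in measurable X]setTI.
apply: (_ : measurable_fun [set: R * R] (fun z : R * R => (z.1, (t - z.2)%R))) => //.
by apply: measurable_fun_pair => //; exact: measurable_funB.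
Qed.

Lemma history_surv k : history X S k (surv k).
Proof.
elim: k => [|k IH]; first exact: history_setT.
apply: history_setI; first exact: (history_mono (leqnSn k)).
by apply: history_setD; [exact: history_in_time|exact: history_stopped].
Qed.

Lemma history_hit k : history X S k.+1 (hit k).
Proof.
apply: history_setI; first by apply: (history_mono (leqnSn k)); exact: history_surv.
by apply: history_setI; [exact: history_in_time|exact: history_stopped].
Qed.

Lemma surv_in_time k : surv k `<=` in_time S t k.
Proof.
case: k => [w _|k w [_ []]//].
by rewrite /in_time/=; case: arr => -> _ _; rewrite lexx t0.
Qed.

Variables (c v : R -> \bar R).
Hypothesis mc : measurable_fun [set: R] c.
Hypothesis mv : measurable_fun [set: R] v.
Hypothesis c0 : forall x, 0 <= c x.
Hypothesis v0 : forall x, 0 <= v x.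

Definition reward (z : R * R) :=
  c z.1 * (\1_stop z)%:E + v z.2 * (\1_(~` stop) z)%:E.

(** From [surv k] the next arrival is accepted and pays [c], or is declined and leaves the
    continuation value [v], or comes too late and pays nothing; [clipped_step] averages over these
    cases. *)
Lemma reward_step k :
  \int[P]_(w in hit k) c (X k.+1 w) + \int[P]_(w in surv k.+1) v (t - S k.+1 w)%R =
  \int[P]_(w in surv k) discounted (fun s => \int[law]_x reward (x, s)) (t - S k w)%R.
Proof.
have mr : measurable_fun [set: R * R] reward.
  apply: emeasurable_funD; apply: emeasurable_funM.
  - exact: (measurableT_comp mc).
  - by apply/measurable_EFinP; exact: measurable_indic.
  - exact: (measurableT_comp mv).
  - by apply/measurable_EFinP; apply: measurable_indic; exact: measurableC.
have r0 z : 0 <= reward z by apply: adde_ge0; apply: mule_ge0; rewrite ?lee_fin.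
rewrite -(clipped_step iid arr ind (@history_surv k) (@surv_in_time k) mr r0).
have mh := history_measurable arr (@history_hit k).
have ms := history_measurable arr (@history_surv k.+1).
rewrite integral_mkcond [X in _ + X]integral_mkcond [RHS]integral_mkcond.
rewrite -ge0_integralD//; last 4 first.
- by move=> w _; apply: erestrict_ge0.
- apply/(measurable_restrictT _ mh); apply: measurable_funTS.
  exact: (measurableT_comp mc).
- by move=> w _; apply: erestrict_ge0.
- apply/(measurable_restrictT _ ms); apply: measurable_funTS.
  apply: (measurableT_comp mv); exact: measurable_funB.
apply: eq_integral => w _; rewrite !patchE /reward/= !indicE.
have [sk|nsk] := pselect (surv k w); last first.
  by rewrite !memNset ?add0e//; [case|case].
rewrite (mem_set sk).
have [ik|nik] := pselect (in_time S t k.+1 w); last first.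
  rewrite (@memNset _ (hit k)) ?(@memNset _ (surv k `&` _)).
  - by rewrite (memNset nik) mule0 add0e.
  - by case=> _ [].
  - by case=> _ [].
rewrite (mem_set ik).
have [st|nst] := pselect (stop (X k.+1 w, (t - S k.+1 w)%R)).
  rewrite (@mem_set _ (hit k))// (@memNset _ (surv k `&` _)); last by case=> _ [].
  by rewrite (mem_set st) memNset ?mule1 ?mule0 ?adde0//; apply.
rewrite (@mem_set _ (surv k `&` _))// (@memNset _ (hit k)); last by case=> _ [].
by rewrite (memNset nst) mem_set// !mule1 mule0 !add0e.
Qed.

End threshold_rule.

(** The integral of a nonnegative function is a supremum over the simple functions below it, hence
    monotone for arbitrary functions. This serves for the payoff [X (tau w) w], taken at a random
    index. *)
Lemma ge0_le_integral_set d (T : measurableType d) (R : realType)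
    (m : {measure set T -> \bar R}) (D : set T) (f g : T -> \bar R) :
  (forall x, D x -> 0 <= f x <= g x) ->
  \int[m]_(x in D) f x <= \int[m]_(x in D) g x.
Proof.
move=> fg; have f0 x : D x -> 0 <= f x by move=> /fg /andP[].
have g0 x : D x -> 0 <= g x by move=> /fg /andP[]; exact: le_trans.
rewrite !ge0_integralE//; apply: le_ereal_sup => _ [h hf <-]; exists h => // x.
apply: (le_trans (hf x)); rewrite !patchE; case: ifPn => //.
by rewrite inE => /fg /andP[].
Qed.

Section survival.
Context d (T : measurableType d) (R : realType) (P : probability T R).
Variables (X0 : {RV P >-> R}) (X S : nat -> {RV P >-> R}).
Hypothesis iid : iid_as X0 X.
Hypothesis arr : poisson_arrivals 1%R S.
Hypothesis ind : independent_seqs P (fun k => X k.+1) (fun k => S k.+1).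
Notation mu := (@lebesgue_measure R).
Notation law := (distribution P X0).
Variable t : R.
Hypothesis t0 : (0 < t)%R.
Variable stop : set (R * R).
Hypothesis mstop : measurable stop.

Local Notation surv := (surv X S t stop).
Local Notation hit := (hit X S t stop).

Lemma gap_lt0 k : P (gap S k @^-1` `]-oo, 0%R[%classic) = 0.
Proof.
case: arr => _ _ /(_ k) H; apply: (eq_trans (H _ (measurable_itv _))).
apply: integral0_eq => x /=; rewrite in_itv/= => x0.
by rewrite lt0_exponential_pdf.
Qed.

Lemma gap_le k : P (gap S k @^-1` `]-oo, t]%classic) = (1 - expR (- t))%:E.
Proof.
have mg (A : set R) : measurable A -> measurable (gap S k @^-1` A).
  by move=> mA; rewrite -[X in measurable X]setTI; exact: measurable_funPT.
rewrite (_ : `]-oo, t]%classic = `]-oo, 0%R[%classic `|` `[0%R, t]%classic); last first.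
  by apply/seteqP; split => x /=; rewrite !in_itv/=; move: t0; lra.
rewrite preimage_setU measureU; [|exact: mg|exact: mg|]; last first.
  apply/seteqP; split => // w [] /=; rewrite !in_itv/= => w0 /andP[].
  by rewrite leNgt w0.
apply: (eq_trans (congr1 (adde^~ _) (gap_lt0 k))).
apply: (eq_trans (add0e _)).
case: arr => _ _ /(_ k) H; apply: (eq_trans (H _ (measurable_itv _))).
by rewrite exponential_prob_itv0c// mulN1r EFinB.
Qed.

Lemma surv_gaps n : surv n `<=` \bigcap_(i < n) gap S i @^-1` `]-oo, t]%classic.
Proof.
elim: n => [|n IH] w; first by move=> _ k.
move=> sw; rewrite bigcap_ltS; split; first by apply: IH; case: sw.
have /= := surv_in_time arr (ltW t0) sw; case: sw => + _.
move=> /(surv_in_time arr (ltW t0)); rewrite /in_time/=.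
move=> /andP[? _] /andP[_ ?].
have : (S n.+1 w - S n w <= t)%R by lra.
by rewrite in_itv.
Qed.

(** Survival forces each of the first [n] gaps to be at most [t], and the gaps are independent
    exponentials. *)
Lemma surv_decay n : P (surv n) <= ((1 - expR (- t)) ^+ n)%:E.
Proof.
have mg k (A : set R) : measurable A -> measurable (gap S k @^-1` A).
  by move=> mA; rewrite -[X in measurable X]setTI; exact: measurable_funPT.
have ms := history_measurable arr (@history_surv _ _ _ P X S t _ mstop n).
apply: (@le_trans _ _ (P (\bigcap_(i < n) gap S i @^-1` `]-oo, t]%classic))).
  apply: le_measure; rewrite ?inE//; last exact: surv_gaps.
  by apply: bigcap_measurableType => k _; exact: mg.
have miG : mutually_independent P (fun k => gap S k : T -> R) by case: arr.
elim: n {ms} => [|n IH].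
  by rewrite expr0 probability_le1//; apply: bigcap_measurableType => k _; exact: mg.
rewrite (mutually_independent_ltS (B := fun=> `]-oo, t]%classic) n miG)//.
rewrite [X in _ * X]gap_le exprSr EFinM lee_wpmul2r//.
by rewrite lee_fin subr_ge0 expR_le1 oppr_le0 ltW.
Qed.

Variables (c v : R -> \bar R).
Hypothesis mc : measurable_fun [set: R] c.
Hypothesis mv : measurable_fun [set: R] v.
Hypothesis c0 : forall x, 0 <= c x.
Hypothesis v0 : forall x, 0 <= v x.

Let conv (s : R) := discounted (fun s => \int[law]_x reward stop c v (x, s)) s.

Let step k := reward_step iid arr ind (ltW t0) mstop mc mv c0 v0 k.

Let mvt k A : measurable_fun A (fun w => v (t - S k w)%R).
Proof.
by apply: measurable_funTS; apply: (measurableT_comp mv); exact: measurable_funB.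
Qed.

Let start : \int[P]_(w in surv 0) v (t - S 0%N w)%R = v t.
Proof.
under eq_integral.
  by move=> w _; rewrite (_ : S 0%N w = 0%R) ?subr0; [over|case: arr].
by rewrite integral_cst//= probability_setT mule1.
Qed.

Let elapsed k w : surv k w -> (0 <= t - S k w <= t)%R.
Proof.
by move=> /(surv_in_time arr (ltW t0)); rewrite /in_time/= => /andP[? ?]; apply/andP; lra.
Qed.

(** Iterates [reward_step]: each step trades the continuation value for at least as much expected
    reward, and the value left on [surv n] is at most [K] times its probability. *)
Lemma subsolution_le_reward (K : R) n :
  (forall s, (0 <= s <= t)%R -> v s <= conv s) -> (forall s, v s <= K%:E) ->
  v t <= \sum_(k < n) \int[P]_(w in hit k) c (X k.+1 w)
         + K%:E * ((1 - expR (- t)) ^+ n)%:E.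
Proof.
move=> vc vK.
have K0 : 0 <= K%:E by exact: le_trans (v0 0%R) (vK 0%R).
have ms k := history_measurable arr (@history_surv _ _ _ P X S t _ mstop k).
suff H : v t <= \sum_(k < n) \int[P]_(w in hit k) c (X k.+1 w) +
    \int[P]_(w in surv n) v (t - S n w)%R.
  apply: (le_trans H); apply: leeD => //.
  apply: (@le_trans _ _ (\int[P]_(w in surv n) K%:E)).
    by apply: ge0_le_integral => //; exact: mvt.
  by rewrite integral_cst// lee_wpmul2l// surv_decay.
elim: n => [|n IH]; first by rewrite big_ord0 add0e start.
apply: (le_trans IH); rewrite big_ord_recr/= -addeA; apply: leeD => //.
rewrite step.
by apply: ge0_le_integral_set => w /elapsed /vc ->; rewrite v0.
Qed.

(** For an exact solution the same iteration is an equality, from which the nonnegative remainder is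
    dropped. *)
Lemma reward_le_solution n :
  (forall s, (0 <= s <= t)%R -> v s = conv s) ->
  \sum_(k < n) \int[P]_(w in hit k) c (X k.+1 w) <= v t.
Proof.
move=> vc.
suff H : v t = \sum_(k < n) \int[P]_(w in hit k) c (X k.+1 w) +
    \int[P]_(w in surv n) v (t - S n w)%R.
  by rewrite H leeDl// integral_ge0.
elim: n => [|n IH]; first by rewrite big_ord0 add0e start.
rewrite IH big_ord_recr/= -addeA step; congr (_ + _).
by apply: eq_integral => w; rewrite inE => /elapsed /vc.
Qed.

End survival.

(** * Subsolutions bound the value from below *)

Section value_lower_bound.
Context d (T : measurableType d) (R : realType) (P : probability T R).
Variables (X0 : {RV P >-> R}) (X S : nat -> {RV P >-> R}).
Hypothesis iid : iid_as X0 X.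
Hypothesis arr : poisson_arrivals 1%R S.
Hypothesis ind : independent_seqs P (fun k => X k.+1) (fun k => S k.+1).
Hypothesis X_ge0 : forall k w, (1 <= k)%N -> (0 <= X k w)%R.
Notation law := (distribution P X0).
Variable t : R.
Hypothesis t0 : (0 < t)%R.
Variable stop : set (R * R).
Hypothesis mstop : measurable stop.

Local Notation surv := (surv X S t stop).
Local Notation hit := (hit X S t stop).

Lemma surv_mono i j : (i <= j)%N -> surv j `<=` surv i.
Proof.
elim: j => [|j IH]; first by rewrite leqn0 => /eqP ->.
by rewrite leq_eqVlt => /predU1P[->//|ij] w [sj _]; exact: IH ij _ sj.
Qed.

(* Obeys the threshold rule up to arrival [m], then stops blindly at [m + 1];
   the truncation loses at most the survival probability of [surv m]. *)
Fixpoint truncated_rule m (w : T) : nat :=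
  if m is m'.+1 then if `[< surv m w >] then m.+1 else truncated_rule m' w else 1.

(** Leaving [surv] at [i.+1] means acceptance or an arrival outside the time window. The rule
    returns [i.+1] in both cases, so its decision lies in the history up to [i.+1]. *)
Lemma truncated_ruleE m w i : truncated_rule m w = i.+1 <->
  ((i < m)%N /\ surv i w /\ ~ surv i.+1 w) \/ (i = m /\ surv m w).
Proof.
elim: m => [|m IH].
  by rewrite [truncated_rule _ _]/=; split => [[<-]|[[]//|[->]//]]; right.
rewrite [truncated_rule _ _]/=; case: asboolP => [sm|nsm].
  split=> [[<-]|]; first by right.
  case=> [[im [_]]|[-> //]]; case.
  exact: (surv_mono im sm).
split=> [/IH[[im ?]|[-> sm]]|[[im [si nsi]]|[_ /nsm//]]].
- by left; split => //; exact: ltnW.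
- by left; split.
apply/IH; move: im; rewrite ltnS leq_eqVlt => /predU1P[im|im]; last by left.
by right; rewrite -im.
Qed.

Lemma truncated_rule_stopping m : stopping_rule X S (truncated_rule m).
Proof.
have tau1 w : (1 <= truncated_rule m w)%N.
  by elim: m => //= m IH; case: asboolP.
split=> // -[//|i] _.
suff : history X S i.+1 (truncated_rule m @^-1` [set i.+1]) by [].
have hs := @history_surv _ _ _ P X S t _ mstop.
rewrite (_ : _ @^-1` _ = (if (i < m)%N then surv i `\` surv i.+1 else set0) `|`
                         (if i == m then surv i else set0)); last first.
  apply/seteqP; split => w /=.
    move=> /truncated_ruleE[[-> ?]|[-> ?]]; first by left.
    by right; rewrite eqxx.
  case; case: ifPn => // im.
    by move=> [si nsi]; apply/truncated_ruleE; left.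
  by move=> si; apply/truncated_ruleE; right; rewrite -(eqP im).
apply: (@measurableU _ (g_sigma_algebraType (history_gen X S i.+1))).
  case: ifP => _; last exact: (@measurable0 _ (g_sigma_algebraType _)).
  apply: (history_setD (history_mono (leqnSn i) (hs i)) (hs i.+1)).
case: ifP => _; last exact: (@measurable0 _ (g_sigma_algebraType _)).
exact: (history_mono (leqnSn i) (hs i)).
Qed.

(** Clipped at 0 to be nonnegative on the whole line; it returns the observed values unchanged. *)
Let c (x : R) : \bar R := (Num.max 0 x)%:E.

Let mc : measurable_fun [set: R] c.
Proof. by apply/measurable_EFinP; exact: measurable_maxr. Qed.

Let c0 x : 0 <= c x. Proof. by rewrite lee_fin le_max lexx. Qed.

(** On [hit k] the rule returns [k.+1] and is paid [X k.+1]. These events are therefore disjoint,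
    and elsewhere the payoff is nonnegative. *)
Lemma reward_le_value m :
  \sum_(k < m.+1) \int[P]_(w in hit k) c (X k.+1 w) <= V_value P X S t.
Proof.
pose tau := truncated_rule m.
apply: (@le_trans _ _ 'E_P[fun w => (X (tau w) w *
   \1_[set w' | (S (tau w') w' <= t)%R] w)%R]); last first.
  apply: ereal_sup_ubound; exists tau => //; exact: truncated_rule_stopping.
rewrite expectation.unlock.
have mh k := history_measurable arr (@history_hit _ _ _ P X S t _ mstop k).
under eq_bigr do rewrite integral_mkcond.
rewrite -ge0_integral_sum//; last 2 first.
- move=> k; apply/(measurable_restrictT _ (mh k)); apply: measurable_funTS.
  exact: (measurableT_comp mc).
- by move=> k w _; apply: erestrict_ge0.
apply: ge0_le_integral_set => w _; apply/andP; split.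
  by apply: sume_ge0 => k _; apply: erestrict_ge0.
have hit_tau k : (k <= m)%N -> hit k w -> tau w = k.+1.
  move=> km [sk [ik st]]; apply/truncated_ruleE.
  move: km; rewrite leq_eqVlt => /predU1P[km|km]; first by right; rewrite -km.
  by left; split => //; split => // -[_ []].
have pay0 : 0 <= ((X (tau w) w * \1_[set w' | (S (tau w') w' <= t)%R] w)%:E : \bar R).
  rewrite lee_fin mulr_ge0//; apply: X_ge0.
  exact: (truncated_rule_stopping m).1.
have [[k [km hk]]|nh] := pselect (exists k, (k <= m)%N /\ hit k w); last first.
  rewrite big1 ?pay0// => k _; rewrite patchE memNset// => hk.
  by apply: nh; exists k; rewrite -ltnS.
rewrite (bigD1 (Ordinal (km : k < m.+1)%N))//= big1 ?adde0; last first.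
  move=> j jk; rewrite patchE memNset// => hj.
  have := hit_tau _ km hk; rewrite (hit_tau j)// ?[(_ <= m)%N]ltn_ord//; last by rewrite -ltnS.
  by case=> jk'; move: jk; rewrite -val_eqE/= jk' eqxx.
rewrite patchE mem_set//= (hit_tau k km hk) /c lee_fin indicE mem_set/=.
  by rewrite mulr1 ge_max X_ge0 ?lexx.
by rewrite (hit_tau k km hk); case: hk => _ [/andP[]].
Qed.

Lemma subsolution_le_value (v : R -> R) (K : R) :
  measurable_fun [set: R] v -> (forall s, 0 <= v s <= K)%R ->
  (forall s, (0 <= s <= t)%R ->
    (v s)%:E <= discounted (fun s => \int[law]_x reward stop c (EFin \o v) (x, s)) s) ->
  (v t)%:E <= V_value P X S t.
Proof.
move=> mv vK vc; apply/lee_addgt0Pr => e e0.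
set q := (1 - expR (- t))%R.
have q01 : (0 <= q < 1)%R.
  by rewrite /q subr_ge0 expR_le1 oppr_le0 (ltW t0)/= ltrBlDr ltrDl expR_gt0.
have K0 : (0 <= K)%R by case/andP: (vK 0%R); exact: le_trans.
have [n Kn] : exists n, (K * q ^+ n.+1 <= e)%R.
  have qn : (fun n => K * q ^+ n.+1)%R @ \oo --> (K * 0)%R.
    apply: cvgMr; rewrite (cvg_shiftS (fun n => q ^+ n)%R).
    by apply: cvg_expr; case/andP: q01 => q0 q1; rewrite ger0_norm.
  rewrite mulr0 in qn; have /cvgrPdist_le/(_ e e0) [n _ /(_ n (leqnn n))] := qn.
  rewrite /= sub0r normrN => H; exists n; exact: le_trans (ler_norm _) H.
have mEv : measurable_fun [set: R] (EFin \o v) by exact/measurable_EFinP.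
apply: (@le_trans _ _ (\sum_(k < n.+1) \int[P]_(w in hit k) c (X k.+1 w)
         + K%:E * (q ^+ n.+1)%:E)).
  apply: (@subsolution_le_reward _ _ _ _ X0 X S iid arr ind t t0 stop mstop c (EFin \o v)) => //.
  - by move=> x; rewrite lee_fin; case/andP: (vK x).
  - by move=> x; rewrite lee_fin; case/andP: (vK x).
by apply: leeD; [exact: reward_le_value|rewrite -EFinM lee_fin].
Qed.

End value_lower_bound.

(** * The expected maximum *)

Section maximum.
Context d (T : measurableType d) (R : realType) (P : probability T R).
Variables (X0 : {RV P >-> R}) (X S : nat -> {RV P >-> R}).
Hypothesis iid : iid_as X0 X.
Hypothesis arr : poisson_arrivals 1%R S.
Hypothesis ind : independent_seqs P (fun k => X k.+1) (fun k => S k.+1).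
Notation mu := (@lebesgue_measure R).
Notation law := (distribution P X0).
Variable t : R.
Hypothesis t0 : (0 < t)%R.

Lemma measurable_arrivals_upto k : measurable (arrivals_upto S t @^-1` [set k]).
Proof.
have mS j : measurable [set w | (S j w <= t)%R].
  rewrite (_ : [set w | _] = S j @^-1` `]-oo, t]%classic); last first.
    by apply/seteqP; split => w /=; rewrite in_itv.
  by rewrite -[X in measurable X]setTI; exact: measurable_funPT.
have pos j : measurable (arrivals_upto S t @^-1` [set j.+1]).
  rewrite (_ : _ @^-1` _ = [set w | (S j.+1 w <= t)%R] `&`
      \bigcap_(i in [set i | (j.+1 < i)%N]) ~` [set w | (S i w <= t)%R]).
    apply: measurableI; first exact: mS.
    by apply: bigcap_measurableType => i _; exact: measurableC.
  apply/seteqP; split => w /=.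
    rewrite /arrivals_upto; case: xgetP => [n -> [Sn nmax] nj|//].
    rewrite -nj; split => // i /= ji Si.
    by have := nmax i Si; rewrite leqNgt ji.
  move=> [Sj Smax]; rewrite /arrivals_upto; apply: xget_unique.
    split=> // i Si; rewrite leqNgt; apply/negP => ji.
    exact: (Smax i ji Si).
  move=> n [Sn nmax]; apply/eqP; rewrite eqn_leq nmax// andbT leqNgt.
  by apply/negP => jn; exact: (Smax n jn Sn).
(* The value 0 is also the default of [xget], so its event is treated as the complement of the
   others. *)
case: k => [|//].
rewrite (_ : _ @^-1` _ = ~` \bigcup_j (arrivals_upto S t @^-1` [set j.+1])).
  by apply: measurableC; exact: bigcup_measurable.
apply/seteqP; split => w /=; first by move=> N0 [j _ /=]; rewrite N0.
by case N: (arrivals_upto _ t w) => [//|n] []; exists n.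
Qed.

Definition running_max w : R :=
  \big[Num.max/0%R]_(1 <= i < (arrivals_upto S t w).+1) X i w.

Lemma measurable_running_max : measurable_fun [set: T] running_max.
Proof.
have mM (s : seq nat) : measurable_fun [set: T] (fun w => \big[Num.max/0%R]_(i <- s) X i w).
  elim: s => [|i s IH].
    under eq_fun do rewrite big_nil; exact: measurable_cst.
  under eq_fun do rewrite big_cons.
  exact: measurable_maxr.
move=> _ A mA; rewrite setTI.
rewrite (_ : _ @^-1` _ = \bigcup_k ((arrivals_upto S t @^-1` [set k]) `&`
    (fun w => \big[Num.max/0%R]_(i <- index_iota 1 k.+1) X i w) @^-1` A)).
  apply: bigcup_measurable => k _; apply: measurableI.
    exact: measurable_arrivals_upto.
  by rewrite -[X in measurable X]setTI; exact: mM.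
apply/seteqP; split => w /=.
  by move=> Aw; exists (arrivals_upto S t w).
by move=> [k _ [<- ]].
Qed.

Section exceedance.
Variable theta : R.
Hypothesis theta0 : (0 <= theta)%R.

Let p : R := fine (P (X0 @^-1` `]theta, +oo[)).

Let stop : set (R * R) := [set z | (theta < z.1)%R].

Let mstop : measurable stop.
Proof.
rewrite (_ : stop = fst @^-1` `]theta, +oo[%classic).
  rewrite -[X in measurable X]setTI; exact: measurable_fst.
by apply/seteqP; split => z /=; rewrite in_itv/= andbT.
Qed.

Local Notation hit := (hit X S t stop).

(** When no gap is negative, arrival times increase, so every index up to the count at time [t] is
    in time, and the first value above [theta] is a hit. *)
Lemma exceedance_hit w : (theta < running_max w)%R ->
  exists k, hit k w \/ (gap S k w < 0)%R.
Proof.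
move=> maxgt; apply: contrapT => /forallNP nk.
have gap0 k : (S k w <= S k.+1 w)%R.
  by rewrite -subr_ge0 leNgt; apply/negP => ?; apply: (nk k); right.
have Smono i j : (i <= j)%N -> (S i w <= S j w)%R.
  elim: j => [|j IH]; first by rewrite leqn0 => /eqP ->.
  by rewrite leq_eqVlt => /predU1P[->//|/IH/le_trans]; exact.
have S0 i : (0 <= S i w)%R by case: arr => /(_ w) <- _ _; exact: Smono.
have [i [i0 iN Xi]] : exists i, [/\ (0 < i)%N, (i <= arrivals_upto S t w)%N &
    (theta < X i w)%R].
  apply: contrapT => no; move: maxgt; rewrite ltNge => /negP; apply.
  rewrite /running_max big_nat; elim/big_rec: _ => // i x /andP[i0 iN] xle.
  rewrite ge_max xle andbT leNgt; apply/negP => Xi; apply: no.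
  by exists i; rewrite -ltnS.
have St j : (j <= i)%N -> (S j w <= t)%R.
  move=> ji; move: (leq_trans ji iN) (leq_trans i0 iN).
  (* The default count 0 is excluded because [i] is positive and at most the count. *)
  rewrite /arrivals_upto; case: xgetP => // n _ [Sn _] jn _.
  exact: le_trans (Smono _ _ jn) Sn.
have [j /andP[j0 Xj] jmin] := ex_minnP (ex_intro _ i (introT andP (conj i0 Xi)) :
  exists j, (0 < j)%N && (theta < X j w)%R).
have ji : (j <= i)%N by apply: jmin; rewrite i0.
have inj k : (k <= j)%N -> in_time S t k w.
  by move=> kj; rewrite /in_time/= S0 St// (leq_trans kj).
case: j j0 Xj jmin ji inj => // j _ Xj jmin ji inj.
apply: (nk j); left; split; last by split; [exact: inj|].
have : (j <= j)%N by []. 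
move: {-2}j => k; elim: k => // k IH kj; split; first exact: IH (ltnW kj).
split; first by apply: inj; exact: ltnW.
by rewrite /stopped/= => Xk; have := jmin k.+1 Xk; rewrite ltnS leqNgt kj.
Qed.

(** The probability that a Poisson process of rate [p], that of arrivals exceeding [theta], has a
    point within time [s]; negative times count as 0. *)
Let v (s : R) : \bar R := (1 - expR (- (p * Num.max 0 s)))%:E.

Let mxge : measurable (X0 @^-1` `]theta, +oo[%classic).
Proof. rewrite -[X in measurable X]setTI; exact: measurable_funPT. Qed.

Let p01 : (0 <= p <= 1)%R.
Proof.
rewrite fine_ge0//= -lee_fin fineK ?fin_num_measure//; exact: probability_le1.
Qed.

Let v0 s : 0 <= v s.
Proof.
rewrite lee_fin subr_ge0 expR_le1 oppr_le0 mulr_ge0//; first by case/andP: p01.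
by rewrite le_max lexx.
Qed.

Let mv : measurable_fun [set: R] v.
Proof.
apply/measurable_EFinP; apply: measurable_funB => //.
apply: measurableT_comp => //; apply: measurableT_comp => //.
by apply: measurable_funM => //; exact: measurable_maxr.
Qed.

Let rewardE (s : R) : (0 <= s)%R -> \int[law]_x reward stop (cst 1) v (x, s) =
  (1 - (1 - p) * expR (- (p * s)))%:E.
Proof.
move=> s0.
pose A : set R := `]theta, +oo[%classic.
have mA : measurable A by exact: measurable_itv.
have lawA : law A = p%:E by rewrite fineK// fin_num_measure.
have lawT : law setT = 1 by exact: probability_setT.
transitivity (\int[law]_x ((\1_A x)%:E + v s * (\1_(~` A) x)%:E)).
  apply: eq_integral => x _; rewrite /reward/= mul1e; congr (_ + _ * _).
    by congr EFin; apply: indic_congr; rewrite /A/= in_itv/= andbT.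
  by congr EFin; apply: indic_congr; rewrite /A/= in_itv/= andbT.
rewrite ge0_integralD//; last 3 first.
- exact/measurable_EFinP/measurable_indic.
- by move=> x _; apply: mule_ge0.
- apply: measurable_funeM; apply/measurable_EFinP; apply: measurable_indic.
  exact: measurableC.
rewrite ge0_integralZl//; last first.
  apply/measurable_EFinP; apply: measurable_indic; exact: measurableC.
have -> : \int[law]_x (\1_A x)%:E = p%:E by rewrite integral_indic// setIT.
have -> : \int[law]_x (\1_(~` A) x)%:E = 1 - p%:E.
  rewrite integral_indic//; last exact: measurableC.
  by rewrite setIT -lawA; exact: probability_setC.
rewrite /v max_r// -EFinB -EFinM -EFinD; congr EFin; ring.
Qed.

Let solution s : (0 <= s <= t)%R ->
  v s = discounted (fun s => \int[law]_x reward stop (cst 1) v (x, s)) s.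
Proof.
move=> /andP[s0 _]; rewrite /discounted.
pose f (x : R) : R := (expR x - (1 - p) * expR ((1 - p) * x))%R.
(* The antiderivative of [f] vanishing at 0; multiplied by [exp (- s)] it gives back [v s]. *)
pose F (x : R) : R := (expR x - expR ((1 - p) * x))%R.
transitivity ((expR (- s))%:E * \int[mu]_(x in `[0%R, s]) (f x)%:E); last first.
  congr (_ * _); apply: eq_integral => x; rewrite inE/= in_itv/= => /andP[x0 _].
  rewrite rewardE// -EFinM; congr EFin; rewrite /f.
  have -> : expR ((1 - p) * x) = (expR x * expR (- (p * x)))%R.
    by rewrite -expRD; congr expR; ring.
  by ring.
have -> : \int[mu]_(x in `[0%R, s]) (f x)%:E = (F s)%:E.
  have dF (x : R) : is_derive x 1%R F (f x).
    rewrite /F /f; apply: is_derive_eq; rewrite /GRing.scale/=; ring.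
  have cF : continuous F.
    move=> x; apply: differentiable_continuous.
    by apply/derivable1_diffP; have := dF x => -[].
  have cf : continuous f.
    move=> x; rewrite /f; apply: cvgB; first exact: continuous_expR.
    apply: cvgMr; apply: (@continuous_comp _ _ _ (fun x => (1 - p) * x)%R).
      exact: mulrl_continuous.
    exact: continuous_expR.
  have F0 : F 0%R = 0%R by rewrite /F mulr0 subrr.
  have [->|s_neq0] := eqVneq s 0%R; first by rewrite set_itv1 integral_set1 F0.
  transitivity ((F s)%:E - (F 0%R)%:E); last by rewrite F0 sube0.
  apply: continuous_FTC2.
  - by rewrite lt_neqAle eq_sym s_neq0.
  - exact: continuous_subspaceT.
  - split.
    + by move=> x _; apply: ex_derive.
    + by apply: cvg_at_right_filter; exact: cF.
    + by apply: cvg_at_left_filter; exact: cF.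
  - by move=> x _; rewrite derive1E; have := dF x => ?; rewrite derive_val.
rewrite /v max_r// -EFinM; congr EFin; rewrite /F mulrBr -!expRD addNr expR0.
by congr (1 - expR _)%R; ring.
Qed.

(** Union bound over the index of the first exceedance and over the null events of a negative gap.
    The hits sum to at most [v t], by [reward_le_solution] with payoff 1. *)
Lemma running_max_tail :
  P (running_max @^-1` `]theta, +oo[) <= (1 - expR (- (t * p)))%:E.
Proof.
have mh k := history_measurable arr (@history_hit _ _ _ P X S t _ mstop k).
pose neg k : set T := gap S k @^-1` `]-oo, 0%R[.
have mneg k : measurable (neg k).
  by rewrite -[X in measurable X]setTI; exact: measurable_funPT.
have cst0 (x : R) : 0 <= (cst 1 : R -> \bar R) x by [].
have sum_le n : \sum_(0 <= k < n) P (hit k `|` neg k) <= v t.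
  apply: le_trans (@reward_le_solution _ _ _ _ X0 X S iid arr ind t t0 stop mstop
    (cst 1) v (measurable_cst _) mv cst0 v0 n solution).
  rewrite big_mkord; apply: lee_sum => k _.
  rewrite integral_cst// mul1e.
  apply: (le_trans (measureU2 _ _ _)) => //.
  by rewrite [X in _ + X]gap_lt0 ?adde0.
apply: (@le_trans _ _ (\sum_(0 <= k <oo) P (hit k `|` neg k))).
  apply: measure_sigma_subadditive => //.
  - by move=> k; exact: measurableU.
  - by rewrite -[X in measurable X]setTI; exact: measurable_running_max.
  - move=> w /=; rewrite in_itv/= andbT => /exceedance_hit[k hk].
    by exists k.
rewrite (_ : (1 - _)%:E = v t); last by rewrite /v max_r ?ltW// mulrC.
apply: lime_le; first exact: is_cvg_nneseries.
by apply: nearW => n; exact: sum_le.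
Qed.

End exceedance.

End maximum.

(** * Comparison of the maximum with the value *)

Section prophet.
Context d (T : measurableType d) (R : realType) (P : probability T R).
Variables (X0 : {RV P >-> R}).
Hypothesis X0_ge0 : forall w, (0 <= X0 w)%R.
Hypothesis EX0 : 'E_P[X0] < +oo.
Notation mu := (@lebesgue_measure R).
Notation law := (distribution P X0).

Definition tail (x : R) : R := fine (ccdf X0 x).

Definition mean_max (v : R) : R := fine (\int[P]_w (Num.max (X0 w) v)%:E).

Lemma tailE x : (tail x)%:E = ccdf X0 x.
Proof. by rewrite fineK// fin_num_measure. Qed.

Lemma tail_ge0 x : (0 <= tail x)%R.
Proof. exact: fine_ge0. Qed.

Lemma measurable_tail : measurable_fun [set: R] tail.
Proof. by apply: measurableT_comp => //; exact: ccdf_measurable. Qed.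

Lemma integral_tail : \int[mu]_(x in `[0%R, +oo[) (tail x)%:E = (fine 'E_P[X0])%:E.
Proof.
rewrite fineK; last first.
  rewrite ge0_fin_numE// unlock; apply: integral_ge0 => w _.
  by rewrite lee_fin.
rewrite ge0_expectation_ccdf//; apply: eq_integral => x _; exact: tailE.
Qed.

Let max_ge0 w v : (0 <= Num.max (X0 w) v)%R.
Proof. by rewrite le_max X0_ge0. Qed.

Let mmax v : measurable_fun [set: T] (fun w => (Num.max (X0 w) v)%:E).
Proof. by apply/measurable_EFinP; exact: measurable_maxr. Qed.

Let max_shift u v : \int[P]_w (Num.max (X0 w) u)%:E <=
  \int[P]_w (Num.max (X0 w) v)%:E + `|u - v|%:E.
Proof.
have -> : `|u - v|%:E = \int[P]_w `|u - v|%:E.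
  by rewrite integral_cst//= probability_setT mule1.
rewrite -ge0_integralD//; last by move=> w _; rewrite lee_fin.
apply: ge0_le_integral_set => w _; rewrite lee_fin max_ge0/= -EFinD lee_fin.
rewrite ge_max; apply/andP; split.
  by rewrite -[leLHS]addr0 lerD// le_max lexx.
rewrite -lerBlDr; apply: (@le_trans _ _ v); last by rewrite le_max lexx orbT.
by have := ler_norm (u - v)%R; lra.
Qed.

Lemma mean_maxE v : (mean_max v)%:E = \int[P]_w (Num.max (X0 w) v)%:E.
Proof.
rewrite fineK// ge0_fin_numE; last by apply: integral_ge0 => w _; rewrite lee_fin.
apply: le_lt_trans (max_shift v 0%R) _; apply: lte_add_pinfty; last exact: ltry.
apply: le_lt_trans EX0; rewrite unlock; apply: ge0_le_integral_set => w _.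
by rewrite !lee_fin max_ge0/= (max_l (X0_ge0 w)).
Qed.

Lemma mean_max_lipschitz u v : (`|mean_max u - mean_max v| <= `|u - v|)%R.
Proof.
have H x y : (mean_max x <= mean_max y + `|x - y|)%R.
  by rewrite -lee_fin EFinD !mean_maxE.
by have := H u v; have := H v u; rewrite ler_norml distrC; lra.
Qed.

Lemma mean_max_tail v : (0 <= v)%R -> (mean_max v)%:E =
  \int[mu]_(x in `[0%R, +oo[) (if (x < v)%R then 1 else tail x)%:E.
Proof.
move=> v0; rewrite mean_maxE.
have mY : measurable_fun [set: T] (fun w => Num.max (X0 w) v) by exact: measurable_maxr.
pose Y : {RV P >-> R} := HB.pack (fun w => Num.max (X0 w) v)
  (isMeasurableFun.Build _ _ _ _ _ mY).
transitivity 'E_P[Y]; first by rewrite expectation.unlock.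
rewrite (@ge0_expectation_ccdf _ _ _ P Y); last by move=> w; exact: max_ge0.
apply: eq_integral => x _.
case: ifPn => xv.
  rewrite -[RHS](@probability_setT _ _ _ P); congr (P _).
  apply/seteqP; split => w //= _; by rewrite in_itv/= andbT lt_max xv orbT.
rewrite tailE; congr (P _); apply/seteqP; split => w /=;
  by rewrite !in_itv/= !andbT lt_max (negbTE xv) orbF.
Qed.

Variables (a : R) (X S : nat -> {RV P >-> R}).
Hypothesis a0 : (0 < a)%R.
Hypothesis Ia : alpha_integral a = 1.
Hypothesis iid : iid_as X0 X.
Hypothesis arr : poisson_arrivals 1%R S.
Hypothesis ind : independent_seqs P (fun k => X k.+1) (fun k => S k.+1).
Hypothesis X_ge0 : forall k w, (1 <= k)%N -> (0 <= X k w)%R.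
Variable t : R.
Hypothesis t0 : (0 < t)%R.

Let w_ (s : R) : R := threshold a t tail s.

Let w_bounds s := threshold_bounds a0 t0 measurable_tail tail_ge0 integral_tail s.

Let mw : measurable_fun [set: R] w_.
Proof. exact: (measurable_threshold a0 Ia t0 measurable_tail tail_ge0 integral_tail). Qed.

(** Accepting exactly the values at or above the threshold yields [max(X0, w_ s)] at remaining time
    [s], with mean [mean_max (w_ s)]. The subsolution property is then [threshold_subsolution]
    multiplied by [exp (- s)]. *)
Lemma threshold_le_value : (w_ t)%:E <= V_value P X S t.
Proof.
pose stop : set (R * R) := [set z | (w_ z.2 <= z.1)%R].
have mstop : measurable stop.
  rewrite -[X in measurable X]setTI; apply: measurable_fun_le => //.
  exact: (measurableT_comp mw).
apply: (subsolution_le_value iid arr ind X_ge0 t0 mstop mw w_bounds) => s s0t.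
have rewardE x : \int[law]_y reward stop (fun x0 => (Num.max 0 x0)%:E) (EFin \o w_) (y, x)
    = (mean_max (w_ x))%:E.
  have mr : measurable_fun [set: R] (fun y =>
      reward stop (fun x0 => (Num.max 0 x0)%:E) (EFin \o w_) (y, x)).
    have mx : measurable [set y | stop (y, x)].
      rewrite (_ : [set y | _] = `[w_ x, +oo[%classic); first exact: measurable_itv.
      by apply/seteqP; split => y /=; rewrite in_itv/= andbT.
    have mmax0 : measurable_fun [set: R] (fun y : R => (Num.max 0 y)%:E).
      by apply/measurable_EFinP; exact: measurable_maxr.
    apply: emeasurable_funD; apply: emeasurable_funM.
    - exact: mmax0.
    - by apply/measurable_EFinP; exact: (measurable_indic mx).
    - exact: (measurable_cst (w_ x)%:E).
    - by apply/measurable_EFinP; exact: (measurable_indic (measurableC mx)).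
  have r0 y : 0 <= reward stop (fun x0 => (Num.max 0 x0)%:E) (EFin \o w_) (y, x).
    rewrite adde_ge0// mule_ge0// lee_fin ?le_max ?lexx//.
    by case/andP: (w_bounds x).
  rewrite mean_maxE ge0_integral_distribution//; apply: eq_integral => w _.
  rewrite /reward/= !indicE.
  have [st|st] := pselect (stop (X0 w, x)).
    rewrite (mem_set st) memNset ?mule1 ?mule0 ?adde0; last by apply.
    by congr EFin; rewrite (max_r (X0_ge0 w)) (max_l st).
  rewrite (memNset st) mem_set// mule1 mule0 add0e; congr EFin.
  by move: st; rewrite /stop/= => /negP; rewrite -ltNge => /ltW /max_r.
rewrite /discounted; under eq_integral do rewrite rewardE -EFinM.
have := threshold_subsolution a0 Ia t0 measurable_tail tail_ge0 integral_tail
  mean_max_lipschitz mean_max_tail s0t.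
move=> /(lee_wpmul2l (x := (expR (- s))%:E)) H.
apply: le_trans (H _); last by rewrite lee_fin expR_ge0.
by rewrite -EFinM mulrA -expRD addNr expR0 mul1r.
Qed.

(** The mean of the maximum is the integral of its tail, and the bounds of [running_max_tail]
    integrate to [threshold_end]. *)
Lemma maximum_le_threshold : M_value P X S t <= ((1 + a) * w_ t)%:E.
Proof.
rewrite (threshold_end a0 Ia t0 measurable_tail tail_ge0 integral_tail).
pose Y : {RV P >-> R} := HB.pack (running_max X S t)
  (isMeasurableFun.Build _ _ _ _ _ (measurable_running_max X S t)).
have Y0 w : (0 <= Y w)%R.
  rewrite /Y/= /running_max big_nat; elim/big_rec: _ => // i x _ x0.
  by rewrite le_max x0 orbT.
rewrite (_ : M_value _ _ _ _ = 'E_P[Y])// ge0_expectation_ccdf//.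
apply: ge0_le_integral_set => theta /=; rewrite in_itv/= andbT => theta0.
by apply/andP; split => //; exact: running_max_tail.
Qed.

Lemma prophet_inequality : M_value P X S t <= (1 + a)%:E * V_value P X S t.
Proof.
apply: (le_trans maximum_le_threshold); rewrite EFinM; apply: lee_wpmul2l.
  by rewrite lee_fin addr_ge0// ltW.
exact: threshold_le_value.
Qed.

End prophet.

Theorem theorem3p2 (R : realType) :
  exists alpha0 : R,
    [/\ unique (fun alpha : R => alpha_integral alpha = 1) alpha0,
        (`|alpha0 - 34149%:R / 10 ^+ 5| <= 5%:R / 10 ^+ 6)%R &
        forall (d : measure_display) (T : measurableType d)
          (P : probability T R) (X0 : {RV P >-> R})
          (X S : nat -> {RV P >-> R}),
          iid_as X0 X ->
          (forall w, (0 <= X0 w)%R) ->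
          (forall k w, (1 <= k)%N -> (0 <= X k w)%R) ->
          'E_P[X0] < +oo ->
          P [set w | X0 w = 0%R] < 1 ->
          poisson_arrivals 1%R S ->
          independent_seqs P (fun k => X k.+1) (fun k => S k.+1) ->
          forall t : R, (0 < t)%R ->
            M_value P X S t <= (1 + alpha0)%:E * V_value P X S t].
Proof.
have [a near_a Ia] := alpha0_exists R.
have a0 : (0 < a)%R.
  (* The numeral is abstracted to some [c >= 1], which already makes [c / 10 ^ 5 - 5 / 10 ^ 6]
     positive. *)
  have : (1 <= 34149%:R :> R)%R by rewrite ler1n.
  move: near_a; move: (34149%:R : R)%R => c + c1; rewrite ler_norml => /andP[+ _].
  have : (0 < (10 * c - 5) / 10 ^+ 6)%R by rewrite divr_gt0 ?exprn_gt0//; lra.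
  have -> : ((10 * c - 5) / 10 ^+ 6 = c / 10 ^+ 5 - 5 / 10 ^+ 6)%R by field.
  by lra.
exists a; split => //; first exact: alpha_integral_unique.
move=> d T P X0 X S iid X0_ge0 X_ge0 EX0 _ arr ind t t0.
exact: (prophet_inequality X0_ge0 EX0 a0 Ia iid arr ind X_ge0 t0).
Qed.
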